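(* Let $(P_n(z))_{n\in\mathbb N}$ be a sequence of polynomials in $\mathbb R[z]$ with $\deg P_n=n$. Suppose that every $P_n$ has only real roots, that all roots of all $P_n$ are contained in some fixed interval $[-C,C]$ with $C$ not depending on $n$, and that the empirical distributions of roots $\frac1n\sum_{z\in\mathbb R:\,P_n(z)=0}\delta_z$ (roots counted with multiplicities) converge weakly, as $n\to\infty$, to some probability measure $\mu$ on $[-C,C]$. Let $g_n(z;t)$, $z\in\mathbb R$, $t\in\mathbb R$, be the polynomial solution $g_n(z;t)=e^{\frac t2\partial_z^2}P_n(z)$ of the heat equation $$\partial_tg_n(z;t)=\frac12\partial_z^2g_n(z;t),\qquad g_n(z;0)=P_n(z).$$ Fix $r>0$. Then the empirical distribution of zeroes of the polynomial $z\mapsto g_n(z;-r^2/n)$ converges weakly, as $n\to\infty$, to the free additive convolution $\mu\boxplus\gamma_{0,2r}$ of $\mu$ and the Wigner semicircle distribution $\gamma_{0,2r}$ with density $x\mapsto\frac1{2\pi r^2}\sqrt{4r^2-x^2}$ on the interval $[-2r,2r]$.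
   Context: The exponential $e^{\frac t2\partial_z^2}=\sum_{m\ge0}\frac{1}{m!}(\frac t2)^m\partial_z^{2m}$ terminates when applied to a polynomial, so $g_n(\cdot;t)$ is a polynomial of degree $n$ for every $t\in\mathbb R$. By the Pólya--Benz theorem, $g_n(\cdot;-s)$ has only real roots for all $s\ge0$. The empirical distribution of zeroes of a polynomial of degree $n$ is the probability measure giving weight $1/n$ to each zero, counted with multiplicity. $\boxplus$ is Voiculescu's free additive convolution of probability measures on $\mathbb R$. *)

(* Defs.v *)
From HB Require Import structures.
From mathcomp Require Import all_boot all_order all_algebra.
From mathcomp Require Import polyrcf complex.
From mathcomp Require Import all_classical all_reals all_analysis.
From mathcomp Require Import measurable_realfun.

Set Implicit Arguments.
Unset Strict Implicit.
Unset Printing Implicit Defensive.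

Import Order.TTheory GRing.Theory Num.Theory.
Import numFieldNormedType.Exports.

Local Open Scope classical_set_scope.
Local Open Scope ring_scope.
Local Open Scope complex_scope.

Definition only_real_roots (R : realType) (p : {poly R}) : Prop :=
  forall z : R[i], root (map_poly (real_complex R) p) z -> complex.Im z = 0.

(* [rootsR p] lists each real root of [p] once; here each root is repeated
   according to its multiplicity. *)
Definition real_roots (R : realType) (p : {poly R}) : seq R :=
  flatten [seq nseq (mup z p) z | z <- rootsR p].

(* Each real zero, counted with multiplicity, has weight 1 / deg p, so this is
   a probability measure exactly when deg p >= 1 and all zeroes are real. *)
Definition empirical_roots (R : realType) (p : {poly R}) :
    {measure set (measurableTypeR R) -> \bar R} :=
  mscale ((size p).-1%:R^-1)%:nng
    (msum (fun k => \d_((real_roots p)`_k : measurableTypeR R))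
       (size (real_roots p))).

(* exp((t/2) d^2/dz^2) p; the terms with m >= size p vanish. *)
Definition heat_flow (R : realType) (t : R) (p : {poly R}) : {poly R} :=
  \sum_(m < size p) ((t / 2) ^+ m / m`!%:R) *: p^`(m.*2).

Definition weak_cvg (R : realType)
    (mu_ : nat -> {measure set (measurableTypeR R) -> \bar R})
    (mu : {measure set (measurableTypeR R) -> \bar R}) : Prop :=
  forall f : R -> R, continuous f -> (exists M : R, forall x, `|f x| <= M) ->
    (\int[mu_ n]_x f x)%R @[n --> \oo] --> (\int[mu]_x f x)%R.

(* [Num.sqrt] is 0 on negative reals, so the density is supported on
   [-2r, 2r]. *)
Definition semicircle_pdf (R : realType) (r x : R) : R :=
  (2 * pi * r ^+ 2)^-1 * Num.sqrt (4 * r ^+ 2 - x ^+ 2).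

Definition semicircle (R : realType) (r : R) :
    set (measurableTypeR R) -> \bar R :=
  fun V => (\int[lebesgue_measure]_(x in V) (semicircle_pdf r x)%:E)%E.

Section semicircle_measure.
Variables (R : realType) (r : R).

Lemma semicircle_pdf_ge0 x : 0 <= semicircle_pdf r x.
Proof.
by rewrite mulr_ge0 ?sqrtr_ge0// invr_ge0 mulr_ge0 ?sqr_ge0// mulr_ge0 ?pi_ge0.
Qed.

Lemma continuous_semicircle_pdf : continuous (semicircle_pdf r).
Proof.
move=> x; apply: cvgM; first exact: cvg_cst.
apply: (continuous_comp (f := fun x : R => 4 * r ^+ 2 - x ^+ 2)).
  by apply: cvgB; [exact: cvg_cst|exact: exprn_continuous].
exact: sqrt_continuous.
Qed.

Lemma measurable_semicircle_pdf :
  measurable_fun [set: measurableTypeR R] (semicircle_pdf r).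
Proof. exact: continuous_measurable_fun continuous_semicircle_pdf. Qed.

Let semicircle0 : semicircle r set0 = 0%E.
Proof. by rewrite /semicircle integral_set0. Qed.

Let semicircle_ge0 A : (0 <= semicircle r A)%E.
Proof.
by rewrite /semicircle integral_ge0//= => x _; rewrite lee_fin semicircle_pdf_ge0.
Qed.

Let semicircle_sigma_additive : semi_sigma_additive (semicircle r).
Proof.
move=> /= A mA tA mUA.
rewrite /semicircle ge0_integral_bigcup//=; last 2 first.
- apply/measurable_EFinP/measurable_funTS; exact: measurable_semicircle_pdf.
- by move=> x _; rewrite lee_fin semicircle_pdf_ge0.
apply: is_cvg_ereal_nneg_natsum_cond => n _ _.
by apply: integral_ge0 => /= x _; rewrite lee_fin semicircle_pdf_ge0.
Qed.

HB.instance Definition _ := isMeasure.Build _ _ _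
  (semicircle r) semicircle0 semicircle_ge0 semicircle_sigma_additive.

End semicircle_measure.

Definition compactly_supported (R : realType)
    (mu : {measure set (measurableTypeR R) -> \bar R}) : Prop :=
  exists M : R, mu (~` [set` `[- M, M]]) = 0%E.

(* A noncommutative probability space is a unital complex algebra [A] with a
   linear functional [phi] such that [phi 1 = 1].  Freeness of [a] and [b] is
   freeness of the unital subalgebras C[a] and C[b]: [phi] vanishes on every
   alternating product of [phi]-centred elements.  A factor is encoded by a pair
   [(i, p)], which stands for [p(a)] if [i] is true and for [p(b)] otherwise. *)
Section free_probability.
Variables (R : realType) (A : algType R[i]) (phi : {scalar A}).

Definition freely_independent (a b : A) : Prop :=
  let ev (u : bool * {poly R[i]}) : A :=
    horner_alg (if u.1 then a else b) u.2 in
  forall s : seq (bool * {poly R[i]}),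
    s != [::] ->
    sorted (fun u v => u.1 != v.1) s ->
    (forall u, u \in s -> phi (ev u) = 0) ->
    phi (\prod_(u <- s) ev u) = 0.

(* The distribution of [a] is the functional p |-> phi (p(a)) on C[X], given by
   its values on monomials.  Only used for compactly supported [mu], which is
   determined by its moments. *)
Definition has_distribution (a : A)
    (mu : {measure set (measurableTypeR R) -> \bar R}) : Prop :=
  forall k : nat, phi (a ^+ k) = ((\int[mu]_x (x ^+ k))%R)%:C.

End free_probability.

(* [nu] is the free additive convolution of [mu1] and [mu2], for compactly
   supported measures: the distribution of a sum of free elements distributed
   according to [mu1] and [mu2].  By freeness the moments of the sum depend only
   on those of [mu1] and [mu2], so [nu] is unique.  The equality of moments of
   order 0 forces all three measures to have mass 1. *)
Definition is_free_convolution (R : realType)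
    (mu1 mu2 nu : {measure set (measurableTypeR R) -> \bar R}) : Prop :=
  [/\ compactly_supported mu1, compactly_supported mu2,
      compactly_supported nu &
      exists (A : algType R[i]) (phi : {scalar A}) (a b : A),
        [/\ phi 1 = 1, freely_independent phi a b,
            has_distribution phi a mu1, has_distribution phi b mu2 &
            has_distribution phi (a + b) nu]].

(* Main.v *)
(** Let m_k(t) be the k-th moment of the empirical distribution of the roots of
    exp(- (t / 2n) d^2/dz^2) P_n.  By Newton's identities the heat equation becomes a
    Burgers equation for the logarithmic derivative, that is,

      2 m_k' = k (sum over a + b = k - 2 of m_a m_b) - (k (k - 1) / n) m_(k-2).

    The solutions of this triangular system are polynomials in t, and as n tends to
    infinity they converge coefficientwise to the solution of the system without the
    last term.  The moments of a + sqrt t b, for a of law mu and b a standard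
    semicircular element free from a, solve that limit system: realise a and b on a
    full Fock space over the polynomials, where a acts on the top cell and b adds or
    removes a cell; decomposing paths at their first passage below a given cell gives
    a recursion for these moments, which can be differentiated in t.  The same paths
    bound the k-th moment by (C + 2r)^k, so that convergence of moments implies weak
    convergence; the limit is the Lebesgue-Stieltjes measure of a distribution
    function obtained from the limits of the averages of ramp functions.

    The roots remain real for an algebraic reason: if Q is the flow of q at a time
    t <= 0, the flow of (X - x) q is (X - x) Q + t Q', and Im (Q'/Q) and Im z have
    opposite signs. *)

Require Import Defs.
From HB Require Import structures.
From mathcomp Require Import all_boot all_order all_algebra.
From mathcomp Require Import polyrcf complex.
From mathcomp Require Import all_classical all_reals all_analysis.
From mathcomp Require Import measurable_realfun.
From mathcomp Require Import ring lra zify.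

Set Implicit Arguments.
Unset Strict Implicit.
Unset Printing Implicit Defensive.

Import Order.TTheory GRing.Theory Num.Theory.
Import numFieldNormedType.Exports.

Local Open Scope classical_set_scope.
Local Open Scope ring_scope.

(** * The Fock space model *)

(** Freeness asks for a linear functional on an algebra, not for positivity, so the Fock space here
    is purely algebraic, without inner product or completion. A measure cannot be read off from it;
    [nu] is the limit of the empirical measures themselves, and the operators only identify its
    moments. No bound on the roots of the flow that is uniform in [n] is established. Only the
    limits of their moments are bounded, and moments of high even order control the tails. Roots are
    never followed in time. Newton's identities are solved over polynomials in the rescaled time
    [s], where the flow runs at time [- s / n], and the solution is compared with lists of roots
    only at [s = 0] and [s = r ^ 2]. With this scaling, averaging the power sums removes [n] from
    the quadratic term and leaves [1 / n] on the linear ones. The semicircle law is matched with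
    [push + pop] through the polynomials [U_n(X / 2)]: both functionals kill them for [n > 0], one
    by a three-term recurrence, the other by orthogonality of sines. *)

Section endomorphism_algebra.
Variables (K : comNzRingType) (V : lmodType K).

Definition is_linear_endo (f : V -> V) : bool := `[< linear f >].

Fact is_linear_endo_submod : submod_closed is_linear_endo.
Proof.
split; first by apply/asboolP => a u v; change (0 = a *: 0 + 0 :> V); rewrite scaler0 addr0.
move=> c f g /asboolP lf /asboolP lg; apply/asboolP => a u v.
change (c *: f (a *: u + v) + g (a *: u + v) =
  a *: (c *: f u + g u) + (c *: f v + g v)).
rewrite lf lg !scalerDr !scalerA (mulrC c a) -!addrA; congr (_ + _).
by rewrite addrCA.
Qed.
HB.instance Definition _ :=
  GRing.isSubmodClosed.Build K (V -> V) is_linear_endo is_linear_endo_submod.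

Record endo := Endo { endo_fun :> V -> V; endoP : is_linear_endo endo_fun }.
HB.instance Definition _ := [isSub for endo_fun].
HB.instance Definition _ := [Choice of endo by <:].
HB.instance Definition _ := [SubChoice_isSubLmodule of endo by <:].

Fact endo_linear (f : endo) : linear f.
Proof. exact: (asboolW (endoP f)). Qed.
HB.instance Definition _ (f : endo) :=
  GRing.isLinear.Build K V V _ f (endo_linear f).

Definition mk_endo (f : V -> V) (lf : linear f) : endo := Endo (asboolT lf).

Lemma endo_ext (f g : endo) : f =1 g -> f = g.
Proof. by move=> fg; apply/val_inj/funext. Qed.

Fact endo_id_linear : linear (@id V). Proof. by []. Qed.
Definition endo_one : endo := mk_endo endo_id_linear.

Fact endo_comp_linear (f g : endo) : linear (f \o g).
Proof. by move=> a u v; rewrite /= !linearP. Qed.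
Definition endo_mul (f g : endo) : endo := mk_endo (endo_comp_linear f g).

Fact endo_mulA : associative endo_mul. Proof. by move=> f g h; apply: endo_ext. Qed.
Fact endo_mul1l : left_id endo_one endo_mul. Proof. by move=> f; apply: endo_ext. Qed.
Fact endo_mul1r : right_id endo_one endo_mul. Proof. by move=> f; apply: endo_ext. Qed.
Fact endo_mulDl : left_distributive endo_mul +%R.
Proof. by move=> f g h; apply: endo_ext. Qed.
Fact endo_mulDr : right_distributive endo_mul +%R.
Proof. by move=> f g h; apply: endo_ext => x; rewrite /= /GRing.add/= linearD. Qed.

Fact endo_scaleAl a f g : a *: endo_mul f g = endo_mul (a *: f) g.
Proof. exact: endo_ext. Qed.
Fact endo_scaleAr a f g : a *: endo_mul f g = endo_mul f (a *: g).
Proof.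
apply: endo_ext => x; change (a *: f (g x) = f (a *: g x)).
by rewrite linearZ.
Qed.

HB.instance Definition _ := GRing.Zmodule_isPzRing.Build endo
  endo_mulA endo_mul1l endo_mul1r endo_mulDl endo_mulDr.

Lemma endo_addE (f g : endo) x : (f + g) x = f x + g x. Proof. by []. Qed.
Lemma endo_scaleE a (f : endo) x : (a *: f) x = a *: f x. Proof. by []. Qed.
Lemma endo_mulE (f g : endo) x : (f * g) x = f (g x). Proof. by []. Qed.

End endomorphism_algebra.

Section fock_space.
Variable K : fieldType.

(* [(k, [:: k1; ...; kn])] stands for the tensor X^k (x) X^k1 (x) ... (x) X^kn of
   the full Fock space over the polynomials with the functional X^k |-> m k.
   Elements of [fock] are linear functionals on that space, on which its operators
   act by transposition; hence products act in the reverse order. *)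
Definition fock := nat * seq nat -> K^o.
HB.instance Definition _ := GRing.Lmodule.on fock.
Definition fock_lmod : lmodType K := GRing.Lmodule.clone K fock _.
Definition fock_endo := endo fock_lmod.
HB.instance Definition _ := GRing.Lmodule.on fock_endo.
HB.instance Definition _ := GRing.PzRing.on fock_endo.

Fact fock_endo_oner_neq0 : (1 : fock_endo) != 0.
Proof.
apply/eqP => /(congr1 (fun f : fock_endo => f (cst 1) (0%N, [::]))).
by apply/eqP; rewrite oner_neq0.
Qed.
HB.instance Definition _ :=
  GRing.PzSemiRing_isNonZero.Build fock_endo fock_endo_oner_neq0.

Fact fock_endo_scaleAl (a : K) (f g : fock_endo) : a *: (f * g) = (a *: f) * g.
Proof. exact: endo_scaleAl. Qed.
HB.instance Definition _ :=
  GRing.Lmodule_isLalgebra.Build K fock_endo fock_endo_scaleAl.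
Fact fock_endo_scaleAr (a : K) (f g : fock_endo) : a *: (f * g) = f * (a *: g).
Proof. exact: endo_scaleAr. Qed.
HB.instance Definition _ :=
  GRing.Lalgebra_isAlgebra.Build K fock_endo fock_endo_scaleAr.

Variable m : nat -> K.

Fact shift_linear : linear (fun F : fock_lmod => (fun u => F (u.1.+1, u.2)) : fock_lmod).
Proof. by []. Qed.
Definition shift : fock_endo := mk_endo shift_linear.

(** Transpose of the creation operator, which puts the constant polynomial [X^0] on top as a new
    cell. *)
Fact push_linear : linear (fun F : fock_lmod => (fun u => F (0%N, u.1 :: u.2)) : fock_lmod).
Proof. by []. Qed.
Definition push : fock_endo := mk_endo push_linear.

(** Transpose of the annihilation operator, which integrates the top cell against [m]. A lone cell
    cannot be removed, hence the value 0 on the empty list. *)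
Definition pop_fun (F : fock_lmod) : fock_lmod :=
  fun u => if u.2 is j :: s then m u.1 *: F (j, s) else 0.
Fact pop_linear : linear pop_fun.
Proof.
move=> a F G; apply/funext => -[k [|j s]]; rewrite /pop_fun !fctE/= ?scaler0 ?addr0//.
by rewrite scalerDr !scalerA mulrC.
Qed.
Definition pop : fock_endo := mk_endo pop_linear.

Definition vacuum : fock_lmod := fun u => if u.2 is [::] then m u.1 else 0.

Definition fock_ev (T : fock_endo) : K := T vacuum (0%N, [::]).
Fact fock_ev_linear : scalar fock_ev. Proof. by []. Qed.
HB.instance Definition _ :=
  GRing.isLinear.Build K fock_endo K _ fock_ev fock_ev_linear.

Definition moment_fun (p : {poly K}) : K := \sum_(i < size p) p`_i * m i.

Lemma horner_alg_sum (A : algType K) (a : A) (p : {poly K}) :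
  horner_alg a p = \sum_(i < size p) p`_i *: a ^+ i.
Proof.
rewrite -{1}[p]coefK poly_def linear_sum; apply: eq_bigr => i _.
by rewrite linearZ/= rmorphXn/= horner_algX mulr_algl.
Qed.

Lemma horner_alg_MXaddC (A : algType K) (a : A) (p : {poly K}) c :
  horner_alg a (p * 'X + c%:P) = a * horner_alg a p + c%:A.
Proof. by rewrite [p * 'X]mulrC rmorphD rmorphM/= horner_algX horner_algC. Qed.

Lemma horner_algZ (A : algType K) (a : A) (p : {poly K}) c :
  horner_alg a (c *: p) = c *: horner_alg a p.
Proof. by rewrite linearZ/= mulr_algl. Qed.

Lemma horner_algD (A : algType K) (a : A) (p q : {poly K}) :
  horner_alg a (p + q) = horner_alg a p + horner_alg a q.
Proof. exact: rmorphD. Qed.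

Lemma endo_horner_MXaddC (a : fock_endo) (p : {poly K}) c F :
  horner_alg a (p * 'X + c%:P) F = a (horner_alg a p F) + c *: F.
Proof. by rewrite horner_alg_MXaddC. Qed.

Lemma fock_endoD (T : fock_endo) F G : T (F + G) = T F + T G.
Proof. exact: linearD. Qed.

Lemma fock_endoZ (T : fock_endo) a F : T (a *: F) = a *: T F.
Proof. exact: linearZ. Qed.

Lemma endo_expS (T : fock_endo) n F : (T ^+ n.+1) F = T ((T ^+ n) F).
Proof. by rewrite exprS. Qed.

Lemma endo_sum (I : Type) (s : seq I) (T : I -> fock_endo) F u :
  (\sum_(i <- s) T i) F u = \sum_(i <- s) T i F u.
Proof.
elim: s => [|i s IH]; first by rewrite !big_nil.
by rewrite !big_cons -IH.
Qed.

Lemma shiftXE n F k s : (shift ^+ n) F (k, s) = F ((k + n)%N, s).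
Proof.
elim: n k => [|n IH] k; first by rewrite addn0.
by rewrite endo_expS/= IH addSnnS.
Qed.

Lemma horner_shiftE p F k s :
  horner_alg shift p F (k, s) = \sum_(i < size p) p`_i * F ((k + i)%N, s).
Proof.
rewrite horner_alg_sum endo_sum; apply: eq_bigr => i _.
by rewrite -shiftXE.
Qed.

(** On tensors: creating a cell, multiplying it by [p] and annihilating it leaves a scalar. This
    relation is the source of freeness. *)
Lemma push_horner_pop p F :
  push (horner_alg shift p (pop F)) = moment_fun p *: F.
Proof.
apply/funext => -[k s]; rewrite /push/= horner_shiftE/= /pop_fun/=.
rewrite [RHS]mulr_suml; apply: eq_bigr => i _.
by rewrite add0n -mulrA.
Qed.

Lemma push_horner_vacuum p : push (horner_alg shift p vacuum) = 0.
Proof.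
apply/funext => -[k s]; rewrite /push/= horner_shiftE/= big1// => i _.
by rewrite mulr0.
Qed.

Lemma fock_ev_horner_shift p : fock_ev (horner_alg shift p) = moment_fun p.
Proof. by rewrite /fock_ev horner_shiftE. Qed.

Lemma fock_ev_shiftX k : fock_ev (shift ^+ k) = m k.
Proof. by rewrite /fock_ev shiftXE. Qed.

Hypothesis m0 : m 0 = 1.

Lemma fock_ev1 : fock_ev 1 = 1.
Proof. by rewrite -[RHS]m0. Qed.

Lemma push_pop F : push (pop F) = F.
Proof.
by apply/funext => -[k s]; rewrite /push/= /pop_fun/= m0 scale1r.
Qed.

Lemma push_vacuum : push vacuum = 0. Proof. exact/funext. Qed.

Definition semicircular : fock_endo := push + pop.

Lemma horner_semicircular (r : K) (q : {poly K}) : exists w : {poly K},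
  forall G, push G = 0 ->
    horner_alg (r *: semicircular) q G = horner_alg pop w G.
Proof.
elim/poly_ind: q => [|q c [w IH]].
  by exists 0 => G _; rewrite !rmorph0.
have [w' [c' ew]] : exists w' c', w = w' * 'X + c'%:P.
  by elim/poly_ind: (w) => [|p d _]; [exists 0, 0; rewrite mul0r addr0|exists p, d].
(* [pop] contributes [w * 'X]; [push] cancels one [pop] in [w' * 'X] and kills the term of [c']. *)
exists ((r *: (w * 'X + w')) + c%:P) => G G0.
rewrite endo_horner_MXaddC IH// horner_algD horner_algZ horner_algC.
rewrite endo_addE !endo_scaleE; congr (_ *: _ + _).
have -> : w * 'X + w' = w * 'X + 0%:P + w' by rewrite addr0.
rewrite horner_algD [RHS]endo_addE endo_horner_MXaddC scale0r addr0.
rewrite /semicircular endo_addE [LHS]addrC; congr (_ + _).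
by rewrite ew endo_horner_MXaddC fock_endoD fock_endoZ push_pop G0 scaler0 addr0.
Qed.

(* [push] kills the functionals of the first kind, hence a centred polynomial in the
   semicircular element maps them to the second kind; a centred polynomial in
   [shift] maps the second kind to the first one. *)
Definition freeness_inv (h : bool) (G : fock_lmod) : Prop :=
  if h then exists p F, [/\ moment_fun p = 0,
      F = vacuum \/ exists F', F = pop F' & G = horner_alg shift p F]
  else exists F, G = pop F.

Lemma pop_horner_comp w G : horner_alg pop (w * 'X) G = pop (horner_alg pop w G).
Proof. by rewrite -[w * 'X]addr0 -polyC0 endo_horner_MXaddC scale0r addr0. Qed.

Lemma fock_ev_horner_semicircular r q w :
  (forall G, push G = 0 ->
    horner_alg (r *: semicircular) q G = horner_alg pop w G) ->
  fock_ev (horner_alg (r *: semicircular) q) = w`_0.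
Proof.
move=> qw; rewrite /fock_ev qw ?push_vacuum//.
elim/poly_ind: w {qw} => [|w c _]; first by rewrite rmorph0 coef0.
rewrite endo_horner_MXaddC coefD coefMX coefC/= add0r.
by change (0 + c * m 0 = c); rewrite m0 mulr1 add0r.
Qed.

Lemma push_freeness_inv G : G = vacuum \/ freeness_inv true G -> push G = 0.
Proof.
case=> [->|[p [F [p0 [->|[F' ->]] ->]]]]; first exact: push_vacuum.
  exact: push_horner_vacuum.
by rewrite push_horner_pop p0 scale0r.
Qed.

Lemma fock_freely_independent (r : K) (s : seq (bool * {poly K})) :
  let ev (u : bool * {poly K}) : fock_endo :=
    horner_alg (if u.1 then shift else r *: semicircular) u.2 in
  s != [::] -> sorted (fun u v => u.1 != v.1) s ->
  (forall u, u \in s -> fock_ev (ev u) = 0) ->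
  fock_ev (\prod_(u <- s) ev u) = 0.
Proof.
move=> ev.
(* The factors reach the vacuum from the right end of the product, so the invariant of a suffix is
   governed by its leftmost factor [u]. *)
have main u s' : sorted (fun u v => u.1 != v.1) (u :: s') ->
    (forall v, v \in u :: s' -> fock_ev (ev v) = 0) ->
    freeness_inv u.1 ((\prod_(u <- u :: s') ev u) vacuum).
  elim: s' u => [|v s' IH] u sus ev0; rewrite big_cons.
    have {ev0} := ev0 u (mem_head _ _); rewrite big_nil mulr1 /ev.
    case: u {sus} => -[] q /=.
      rewrite fock_ev_horner_shift => q0; exists q, vacuum; split => //; by left.
    have [w hw] := horner_semicircular r q.
    rewrite (fock_ev_horner_semicircular hw) hw ?push_vacuum//.
    elim/poly_ind: w {hw} => [|w c _]; first by move=> _; exists 0; rewrite rmorph0; exact: esym (linear0 pop).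
    rewrite coefD coefMX coefC/= add0r => ->.
    by exists (horner_alg pop w vacuum); rewrite addr0 pop_horner_comp.
  have /andP[uv sv] : (u.1 != v.1) && sorted (fun u v => u.1 != v.1) (v :: s') by [].
  have {IH} := IH v sv (fun x xs => ev0 x (mem_behead (s := u :: v :: s') xs)).
  rewrite endo_mulE; set G := (_ vacuum) => invG.
  have {ev0} := ev0 u (mem_head _ _); rewrite /ev.
  case: u uv {sus} => -[] q /= uv.
    rewrite fock_ev_horner_shift => q0; exists q, G; split => //; right.
    by move: uv invG; case: (v.1).
  have [w hw] := horner_semicircular r q.
  rewrite (fock_ev_horner_semicircular hw) hw ?push_freeness_inv//; last first.
    by right; move: uv invG; case: (v.1).
  elim/poly_ind: w {hw} => [|w c _]; first by move=> _; exists 0; rewrite rmorph0; exact: esym (linear0 pop).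
  rewrite coefD coefMX coefC/= add0r => ->.
  by exists (horner_alg pop w G); rewrite addr0 pop_horner_comp.
(* Functionals of both kinds vanish at [(0, [::])]: [pop] is 0 on a lone cell, and on the vacuum a
   centred [p] yields its moment 0. *)
case: s => // u s _ sus ev0; have := main u s sus ev0; rewrite /fock_ev.
move: (_ vacuum) => G; case: (u.1) => /= [[p [F [p0 FF ->]]]|[F ->//]].
rewrite horner_shiftE; case: FF => [->//|[F' ->]].
by rewrite big1// => i _; rewrite mulr0.
Qed.

End fock_space.

(** * Formal power series *)

Section formal_power_series.
Variable S : comNzRingType.

Definition fps := nat -> S.
HB.instance Definition _ := GRing.Zmodule.on fps.

Definition fps_mul (f g : fps) : fps := fun n => \sum_(i < n.+1) f i * g (n - i)%N.
Definition fps_one : fps := fun n => (n == 0%N)%:R.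

(** A coefficient of a product only sees truncations, so the ring laws are inherited from
    polynomials. *)
Lemma fps_mul_poly (f g : fps) N n : (n < N)%N ->
  fps_mul f g n = ((\poly_(i < N) f i) * (\poly_(i < N) g i))`_n.
Proof.
move=> nN; rewrite coefM; apply: eq_bigr => i _; rewrite !coef_poly.
have -> : (i < N)%N by rewrite (leq_trans (ltn_ord i)).
by rewrite (leq_ltn_trans (leq_subr _ _) nN).
Qed.

Fact fps_mulC : commutative fps_mul.
Proof.
by move=> f g; apply/funext => n; rewrite !(@fps_mul_poly _ _ n.+1)// mulrC.
Qed.
Fact fps_mulA : associative fps_mul.
Proof.
move=> f g h; apply/funext => n.
transitivity (((\poly_(i < n.+1) f i) * (\poly_(i < n.+1) g i) *
    (\poly_(i < n.+1) h i))`_n).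
  rewrite -mulrA coefM; apply: eq_bigr => i _.
  rewrite (@fps_mul_poly g h n.+1) ?ltnS ?leq_subr// coef_poly.
  by rewrite ltn_ord.
rewrite coefM; apply: eq_bigr => i _.
by rewrite (@fps_mul_poly f g n.+1)// coef_poly ltnS leq_subr.
Qed.
Fact fps_mul1 : left_id fps_one fps_mul.
Proof.
move=> f; apply/funext => n; rewrite /fps_mul big_ord_recl/= mul1r subn0.
by rewrite big1 ?addr0// => i _; rewrite mul0r.
Qed.
Fact fps_mulD : left_distributive fps_mul +%R.
Proof.
move=> f g h; apply/funext => n; rewrite [RHS](_ : _ = fps_mul f h n + fps_mul g h n)//.
by rewrite /fps_mul -big_split; apply: eq_bigr => i _; exact: mulrDl.
Qed.
Fact fps_one_neq0 : fps_one != 0.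
Proof. by apply/eqP => /(congr1 (@^~ 0%N)); apply/eqP; exact: oner_neq0. Qed.

HB.instance Definition _ := GRing.Zmodule_isComNzRing.Build fps
  fps_mulA fps_mulC fps_mul1 fps_mulD fps_one_neq0.

Lemma fpsME (f g : fps) n : (f * g) n = \sum_(i < n.+1) f i * g (n - i)%N.
Proof. by []. Qed.
Lemma fpsDE (f g : fps) n : (f + g) n = f n + g n. Proof. by []. Qed.
Lemma fpsNE (f : fps) n : (- f) n = - f n. Proof. by []. Qed.

Definition fpsX : fps := fun n => (n == 1%N)%:R.
Definition fpsC (a : S) : fps := fun n => if n is 0 then a else 0.

Lemma fpsCM a f n : (fpsC a * f) n = a * f n.
Proof.
rewrite fpsME big_ord_recl/= subn0 big1 ?addr0// => i _.
by rewrite mul0r.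
Qed.

Lemma fpsXM f n : (fpsX * f) n = if n is n'.+1 then f n' else 0.
Proof.
rewrite fpsME; case: n => [|n]; first by rewrite big_ord_recl big_ord0 mul0r addr0.
rewrite 2!big_ord_recl /fpsX/= mul0r mul1r add0r subSS subn0.
by rewrite big1 ?addr0// => i _; rewrite mul0r.
Qed.

Lemma fpsX2M f n : (fpsX * (fpsX * f)) n = if n is n'.+2 then f n' else 0.
Proof. by rewrite fpsXM; case: n => // n; rewrite fpsXM. Qed.

(** The derivation [x d/dx], which leaves the index of a coefficient in place. *)
Definition euler (f : fps) : fps := fun n => f n *+ n.

Lemma eulerD f g : euler (f + g) = euler f + euler g.
Proof. by apply/funext => n; exact: mulrnDl. Qed.

Lemma eulerN f : euler (- f) = - euler f.
Proof. by apply/funext => n; exact: mulNrn. Qed.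

Lemma eulerM f g : euler (f * g) = euler f * g + f * euler g.
Proof.
apply/funext => n; rewrite fpsDE /euler !fpsME -sumrMnl -big_split/=.
apply: eq_bigr => i _; rewrite mulrnAl mulrnAr -mulrnDr subnKC//.
by rewrite -ltnS.
Qed.

Lemma euler_fpsC a : euler (fpsC a) = 0.
Proof. by apply/funext => -[|n]; [exact: mulr0n|exact: mul0rn]. Qed.

Lemma euler_fpsX : euler fpsX = fpsX.
Proof. by apply/funext => -[|[|n]]; [exact: mulr0n|exact: mulr1n|exact: mul0rn]. Qed.

Lemma fps_mul_eq0 (f g : fps) : f 0%N = 1 -> f * g = 0 -> g = 0.
Proof.
move=> f0 fg; apply/funext => n.
elim/ltn_ind: n => n IH; have := congr1 (@^~ n) fg.
rewrite fpsME big_ord_recl/= f0 mul1r subn0 big1 ?addr0// => i _.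
by rewrite IH ?mulr0// /bump/=; have := ltn_ord i; lia.
Qed.

End formal_power_series.

(** * Power series whose coefficients are polynomials in time *)

Section fps_poly.
Variable R : comNzRingType.
Implicit Types f g : fps {poly R}.

Definition fps_deriv f : fps {poly R} := fun n => (f n)^`().

Lemma fps_derivM f g : fps_deriv (f * g) = fps_deriv f * g + f * fps_deriv g.
Proof.
apply/funext => n; rewrite fpsDE /fps_deriv !fpsME.
rewrite raddf_sum -big_split; apply: eq_bigr => i _ /=.
by rewrite derivM.
Qed.

Lemma fps_derivD f g : fps_deriv (f + g) = fps_deriv f + fps_deriv g.
Proof. by apply/funext => n; exact: derivD. Qed.

Lemma fps_deriv_fpsC (a : {poly R}) : fps_deriv (fpsC a) = fpsC a^`().
Proof. by apply/funext => -[|n]//; exact: deriv0. Qed.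

Lemma fps_derivX : fps_deriv (@fpsX {poly R}) = 0.
Proof. by apply/funext => -[|[|n]]; [exact: deriv0|exact: derivC|exact: deriv0]. Qed.

End fps_poly.

(** * Power sums along the heat flow *)

Section fps_inverse.
Variable S : comNzRingType.
Implicit Types f g : fps S.

Lemma fps_exp_coef0 f j n : f 0%N = 0 -> (n < j)%N -> (f ^+ j) n = 0.
Proof.
move=> f0; elim: j n => // j IH n nj; rewrite exprS fpsME big1// => i _.
case: i => -[|i] iP /=; first by rewrite f0 mul0r.
by rewrite IH ?mulr0//; lia.
Qed.

Lemma fps_sumE (I : Type) (s : seq I) (T : I -> fps S) n :
  (\sum_(i <- s) T i) n = \sum_(i <- s) T i n.
Proof.
elim: s => [|i s IH]; first by rewrite !big_nil.
by rewrite !big_cons fpsDE IH.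
Qed.

Lemma fps_inverse f : f 0%N = 1 -> exists g, f * g = 1.
Proof.
move=> f0; pose u := 1 - f.
have u0 : u 0%N = 0 by rewrite /u fpsDE fpsNE f0 subrr.
(* The geometric series of [u]: since [u ^+ j] starts in degree [j], each coefficient is a finite
   sum. *)
pose g : fps S := fun n => \sum_(j < n.+1) (u ^+ j) n.
have gE N n : (n < N)%N -> g n = (\sum_(j < N) u ^+ j) n.
  move=> nN; rewrite fps_sumE /g -!(big_mkord xpredT (fun j => (u ^+ j) n)).
  rewrite [RHS](big_cat_nat (n := n.+1))//= [X in _ = _ + X]big_nat_cond [X in _ = _ + X]big1 ?addr0//.
  by move=> i; rewrite andbT => /andP[ni _]; rewrite fps_exp_coef0.
exists g; apply/funext => n.
have -> : (f * g) n = (f * \sum_(j < n.+1) u ^+ j) n.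
  rewrite !fpsME; apply: eq_bigr => i _; congr (_ * _).
  by apply: gE; rewrite ltnS leq_subr.
have -> : f = - (u - 1) by rewrite /u; ring.
by rewrite mulNr -subrX1 fpsNE fpsDE fps_exp_coef0// add0r fpsNE opprK.
Qed.

End fps_inverse.

Section fps_map.
Variables (S S' : comNzRingType) (h : {rmorphism S -> S'}).

Definition fps_map (f : fps S) : fps S' := fun n => h (f n).

Lemma fps_mapM f g : fps_map (f * g) = fps_map f * fps_map g.
Proof.
apply/funext => n; rewrite /fps_map !fpsME rmorph_sum.
by apply: eq_bigr => i _; exact: rmorphM.
Qed.

End fps_map.

(** * Newton's identities for reversed polynomials *)

Section newton.
Variable S : comNzRingType.

Definition power_sums (ys : seq S) : fps S := fun k => \sum_(y <- ys) y ^+ k.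

(** The reversal [x^n p(1 / x)]: it turns the factors [z - y] into [1 - y x], which are invertible
    as power series. *)
Definition rev_poly (n : nat) (p : {poly S}) : fps S :=
  fun k => if (k <= n)%N then p`_(n - k) else 0.

Lemma rev_poly_prod (ys : seq S) :
  rev_poly (size ys) (\prod_(y <- ys) ('X - y%:P)) =
  \prod_(y <- ys) (1 - fpsC y * fpsX S).
Proof.
elim: ys => [|y ys IH].
  rewrite !big_nil; apply/funext => -[|k]//; rewrite /rev_poly/= coef1.
  by [].
rewrite !big_cons -IH; apply/funext => k.
rewrite [RHS](_ : _ = rev_poly (size ys) (\prod_(y <- ys) ('X - y%:P)) k - y *
  (if k is k'.+1 then rev_poly (size ys) (\prod_(y <- ys) ('X - y%:P)) k' else 0)); last first.
  by rewrite mulrBl mul1r fpsDE fpsNE -mulrA fpsCM fpsXM.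
rewrite /rev_poly/=; have sz : size (\prod_(y <- ys) ('X - y%:P)) = (size ys).+1 by rewrite size_prod_XsubC.
rewrite mulrBl coefB coefXM coefCM; case: k => [|k].
  by rewrite /= !subn0 mulr0 subr0 [X in _ * X]nth_default ?sz// mulr0 subr0.
rewrite subSS ltnS; case: (leqP k (size ys)) => kn; last first.
  by rewrite ifF ?mulr0 ?subr0//; lia.
rewrite [in LHS]subn_eq0; case: ltnP => nk //.
by congr (_ `_ _ - _); lia.
Qed.

(** Logarithmic derivative: [- x q' / q] is the sum of the [y x / (1 - y x)], and the term
    [q *+ size ys] supplies the power sum of order 0. *)
Lemma newton (ys : seq S) :
  let q := \prod_(y <- ys) (1 - fpsC y * fpsX S) in
  q * power_sums ys = q *+ size ys - euler q.
Proof.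
rewrite /=; elim: ys => [|y ys IH].
  rewrite !big_nil mulr0n (_ : power_sums [::] = 0) ?mulr0; last first.
    by apply/funext => k; rewrite /power_sums big_nil.
  rewrite (_ : 1 = fpsC (1 : S)) ?euler_fpsC ?subr0//.
  by apply/funext => -[].
rewrite !big_cons eulerM; set Q := \prod_(_ <- _) _ in IH *.
rewrite eulerD eulerN eulerM euler_fpsC euler_fpsX.
rewrite (_ : 1 = fpsC (1 : S)) ?euler_fpsC; last by apply/funext => -[].
rewrite (_ : fpsC (1 : S) = 1); last by apply/funext => -[].
have -> : power_sums (y :: ys) = power_sums [:: y] + power_sums ys.
  by apply/funext => k; rewrite fpsDE /power_sums big_cons big_seq1.
have y1 : (1 - fpsC y * fpsX S) * power_sums [:: y] = 1.
  apply/funext => k; rewrite mulrBl mul1r fpsDE fpsNE -mulrA fpsCM fpsXM.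
  by rewrite /power_sums; case: k => [|k]; rewrite !big_seq1 ?mulr0 ?subr0// -exprS subrr.
rewrite mulrDr mulrAC y1 -mulrA IH /= mulrS; ring.
Qed.

End newton.

(** * From the heat equation to the Burgers equation for power sums *)

Section heat_power_sums.
Variables (R : numFieldType) (n : nat) (P : {poly R}) (c : R).
Hypotheses (n_gt0 : (0 < n)%N) (sizeP : size P = n.+1).
Let X := fpsX {poly R}.
(** On a reversed polynomial of degree [n] this is [z d/dz], because the coefficient of index [k]
    belongs to [z^(n - k)]. *)
Let D (f : fps {poly R}) := f *+ n - euler f.

(** Reversed coefficients of [exp(c s d^2/dz^2) P], as polynomials in the time [s]. *)
Definition heat_coef : fps {poly R} := fun k =>
  if (k <= n)%N then
    \sum_(m < n.+1) ((c ^+ m / m`!%:R) * (P^`(m.*2))`_(n - k)) *: 'X^m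
  else 0.

Lemma fpsMnE (S : comNzRingType) (f : fps S) k j : (f *+ j) k = f k *+ j.
Proof. by elim: j => // j IH; rewrite !mulrS fpsDE IH. Qed.

Lemma degree_opE f k : (k <= n)%N -> D f k = f k *+ (n - k).
Proof. by move=> kn; rewrite /D fpsDE fpsNE fpsMnE /euler mulrnBr. Qed.

Lemma degree_op_eq0 f k : f k = 0 -> D f k = 0.
Proof. by move=> f0; rewrite /D fpsDE fpsNE fpsMnE /euler f0 !mul0rn subr0. Qed.

(** The heat equation in reversed form: [z^2 d^2/dz^2] is [D^2 - D] for [D = z d/dz], and division
    by [z^2] becomes multiplication by [X^2]. *)
Lemma heat_coef_deriv :
  fps_deriv heat_coef = fpsC c%:P * (X * (X * (D (D heat_coef) - D heat_coef))).
Proof.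
have top k i : (n < i + k)%N -> (P^`(k))`_i = 0.
  by move=> ki; rewrite coef_derivn nth_default ?mul0rn// sizeP addnC.
apply/funext => k; rewrite fpsCM fpsX2M /fps_deriv.
have [kn|nk] := leqP k n; last first.
  rewrite [heat_coef k]/heat_coef leqNgt nk/= deriv0.
  case: k nk => [|[|k]] nk; rewrite ?mulr0//.
  (* If [k <= n], then [n - k] is 0 or 1 here, and [(n - k)^2 - (n - k)] vanishes. *)
  have [kn|kn] := leqP k n.
    rewrite fpsDE fpsNE !degree_opE// -mulrnA -mulrnBr; last by nia.
    by rewrite (_ : _ - _ = 0)%N ?mulr0n ?mulr0//; nia.
  have H0 : heat_coef k = 0 by rewrite /heat_coef leqNgt kn.
  by rewrite fpsDE fpsNE !degree_op_eq0// subrr mulr0.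
rewrite {1}/heat_coef kn raddf_sum.
under eq_bigr => m _ do rewrite /= derivZ derivXn -scalerMnr scalerMnl.
rewrite big_ord_recl mulr0n scale0r add0r.
under eq_bigr => m _ do rewrite lift0.
case: k kn => [|[|k]] kn; [| |rewrite fpsDE fpsNE !degree_opE; try by lia].
- by rewrite mulr0 big1// => m _; rewrite top ?mulr0 ?mul0rn ?scale0r//; lia.
- by rewrite mulr0 big1// => m _; rewrite top ?mulr0 ?mul0rn ?scale0r//; lia.
rewrite -mulrnA -mulrnBr; last by nia.
rewrite /heat_coef ifT; last by lia.
rewrite big_ord_recr/= top ?mulr0 ?scale0r ?addr0; last by lia.
rewrite mul_polyC -scalerMnr scaler_sumr -sumrMnl; apply: eq_bigr => m _.
rewrite scalerA [RHS]scalerMnl; congr (_ *: _).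
rewrite !coef_deriv (_ : (n - k.+2).+2 = n - k)%N; last by lia.
rewrite -mulrnA factS natrM invfM exprS.
have m1 : m.+1%:R != 0 :> R by rewrite pnatr_eq0.
rewrite [in LHS]mulrnAr mulrnAC; congr (_ *+ _); last first.
  have -> : (n - k = (n - k.+2).+2)%N by lia.
  by rewrite mulnC; nia.
have m0 : m`!%:R != 0 :> R by rewrite pnatr_eq0 -lt0n fact_gt0.
rewrite -[LHS]mulr_natr; move: m0 m1; move: (_`!%:R) (_.+1%:R) => b a b0 a0.
by field; rewrite a0 b0.
Qed.

Lemma heat_coef0 : P \is monic -> heat_coef 0%N = 1.
Proof.
move=> /monicP; rewrite lead_coefE sizeP => lP.
rewrite /heat_coef/= big_ord_recl subn0 big1 ?addr0.
  by rewrite fact0 divr1 mul1r derivn0 lP scale1r.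
move=> m _; rewrite coef_derivn nth_default ?mul0rn ?mulr0 ?scale0r// sizeP.
by rewrite lift0; lia.
Qed.

(* Burgers equation for the logarithmic derivative of the heat flow, read off on
   the power sums. *)
Lemma power_sums_deriv (p : fps {poly R}) : P \is monic ->
  heat_coef * p = D heat_coef ->
  fps_deriv p = - euler (fpsC c%:P * (X * (X * (p * p - euler p - p)))).
Proof.
move=> /heat_coef0 q0 qp; set q := heat_coef in q0 qp.
(* Cole-Hopf: [D q = q p] gives [D (D q) = q (p^2 - euler p)], so the linear equation reads
   [q' = q h]. Differentiating [q p = D q] in time and cancelling [q] then yields the claim. *)
have dq : fps_deriv q = q * (fpsC c%:P * (X * (X * (p * p - euler p - p)))).
  rewrite heat_coef_deriv -/q -qp /D eulerM -mulrnAl.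
  have -> : q *+ n = q * p + euler q by rewrite qp /D subrK.
  by ring.
set h := fpsC _ * _ in dq *.
apply/eqP; rewrite -subr_eq0 opprK; apply/eqP; apply: (fps_mul_eq0 q0).
have := congr1 (@fps_deriv R) qp; rewrite /D fps_derivM fps_derivD dq.
rewrite (_ : fps_deriv (q *+ n) = fps_deriv q *+ n); last first.
  by apply/funext => k; rewrite /fps_deriv !fpsMnE derivMn.
rewrite (_ : fps_deriv (- euler q) = - euler (fps_deriv q)); last first.
  by apply/funext => k; rewrite /fps_deriv !fpsNE derivN derivMn.
rewrite dq eulerM -mulrnAl => e.
have {}e : q * fps_deriv p = q *+ n * h - (euler q * h + q * euler h) - q * h * p.
  by rewrite -e; ring.
rewrite mulrDr e (_ : q *+ n = q * p + euler q); first by ring.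
by rewrite qp /D subrK.
Qed.

End heat_power_sums.

(** Newton's identities can be solved over polynomials in time because [q] has constant coefficient
    1. The solution exists at all times, whether or not the roots are known there. *)
Lemma heat_moments (R : numFieldType) (n : nat) (xs ys : seq R) (t : R) :
  (0 < n)%N -> size xs = n -> size ys = n ->
  let c : R := - (n%:R *+ 2)^-1 in
  let P := \prod_(x <- xs) ('X - x%:P) in
  (forall k, (k <= n)%N ->
    (\prod_(y <- ys) ('X - y%:P))`_(n - k) = (heat_coef n P c k).[t]) ->
  exists M : fps {poly R},
    [/\ fps_deriv M *+ 2 = euler (fpsX _ * fpsX _ *
           (M * M - fpsC (n%:R^-1)%:P * (euler M + M))),
        forall k, (M k).[0] = n%:R^-1 * power_sums xs k &
        forall k, (M k).[t] = n%:R^-1 * power_sums ys k].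
Proof.
move=> n0 sx sy c P hy.
have szP : size P = n.+1 by rewrite size_prod_XsubC sx.
have mP : P \is monic by exact: monic_prod_XsubC.
set q := heat_coef n P c in hy.
have q0 : q 0%N = 1 by exact: heat_coef0.
have [q' qq'] := fps_inverse q0.
pose p := q' * (q *+ n - euler q).
have qp : q * p = q *+ n - euler q by rewrite /p mulrA qq' mul1r.
have dp := power_sums_deriv n0 szP mP qp.
(* At a time [u] where the flow splits with roots [ws], evaluation turns [q] into their reversed
   product, and Newton's identities determine the power sums. *)
have evalE u ws : size ws = n -> (forall k, (k <= n)%N ->
    (\prod_(y <- ws) ('X - y%:P))`_(n - k) = (q k).[u]) ->
    forall k, (p k).[u] = power_sums ws k.
  move=> sw hw; pose ev := fps_map (horner_eval u).
  have qw : ev q = \prod_(y <- ws) (1 - fpsC y * fpsX R).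
    rewrite -rev_poly_prod sw; apply/funext => k; rewrite /rev_poly.
    have [kn|nk] := leqP k n; first by rewrite hw.
    by rewrite /ev /fps_map /q /heat_coef leqNgt nk/= rmorph0.
  have nw := newton ws; rewrite /= -qw sw in nw.
  have evp : ev q * ev p = ev q *+ n - euler (ev q).
    rewrite -fps_mapM qp; apply/funext => k.
    rewrite /ev /fps_map !fpsDE !fpsNE !fpsMnE /euler.
    by rewrite rmorphB !rmorphMn.
  suff e : ev p - power_sums ws = 0.
    by move=> k; apply/eqP; rewrite -subr_eq0; apply/eqP; exact: (congr1 (@^~ k) e).
  apply: (@fps_mul_eq0 _ (ev q)); last by rewrite mulrBr evp nw subrr.
  by rewrite /ev /fps_map q0 rmorph1.
have nn0 : n%:R != 0 :> R by rewrite pnatr_eq0 -lt0n.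
exists (fpsC (n%:R^-1)%:P * p); split; last first.
- by move=> k; rewrite fpsCM hornerM hornerC (evalE t ys).
- move=> k; rewrite fpsCM hornerM hornerC (evalE 0 xs) // => j jn.
  rewrite /q /heat_coef jn horner_sum big_ord_recl [X in _ = _ + X]big1 ?addr0.
    by rewrite hornerZ !expr0 hornerC fact0 divr1 mul1r mulr1 derivn0.
  by move=> i _; rewrite lift0 hornerZ hornerXn expr0n mulr0.
set a := fpsC (n%:R^-1)%:P.
have dc : fpsC c%:P *+ 2 = - a.
  apply/funext => -[|k]; rewrite fpsMnE fpsNE/= ?mul0rn ?oppr0//.
  rewrite -polyCMn -polyCN; congr (_%:P). rewrite /c.
  rewrite mulNrn -[n%:R *+ 2]mulr_natr -mulr_natr; congr (- _).
  by field; rewrite nn0.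
have da : fps_deriv a = 0.
  by rewrite fps_deriv_fpsC derivC; apply/funext => -[].
have ea : euler a = 0 by exact: euler_fpsC.
set X := fpsX _.
pose u := X * (X * (p * p - euler p - p)).
have -> : X * X * (a * p * (a * p) - a * (euler (a * p) + a * p)) = a * a * u.
  by rewrite eulerM ea /u; ring.
rewrite -/X -/u in dp; clearbody u.
rewrite fps_derivM da dp !eulerM ea euler_fpsC.
have -> : a * a * euler u = - (fpsC c%:P *+ 2) * a * euler u by rewrite dc; ring.
by ring.
Qed.

(** * Moments of the free sum *)

Section walks.
Variables (S : comNzRingType) (m : nat -> S) (t : S).

(* The value at [u] of the [j]-th iterate of [shift + push + t *: pop] on the
   vacuum. *)
Fixpoint walk (j : nat) (u : nat * seq nat) : S :=
  if j is j'.+1 then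
    walk j' (u.1.+1, u.2) + walk j' (0%N, u.1 :: u.2)
    + t * (if u.2 is i :: s then m u.1 * walk j' (i, s) else 0)
  else if u.2 is [::] then m u.1 else 0.

(* Decomposition at the first time the cell [k] becomes the top one. *)
Lemma walk_split j k' s' k s :
  walk j (k', s' ++ k :: s) =
  t * \sum_(p < j) walk p (k', s') * walk (j - p.+1)%N (k, s).
Proof.
elim: j k' s' => [|j IH] k' s'; first by case: s' => [|? ?]; rewrite big_ord0 mulr0.
rewrite big_ord_recl subSS subn0.
under eq_bigr => i _ do rewrite lift0 subSS /= !mulrDl.
rewrite !big_split/= IH (IH 0%N (k' :: s')).
set C := (X in _ + t * X = _); set D := (X in _ * (X + _)); set F := (X in _ = _ * (_ + (_ + X))).
(* A pop at the first step either reveals the cell [k] at once, which is [D], or stays within [s'],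
   which is [F]. *)
suff -> : C = D + F by ring.
rewrite {}/C {}/D {}/F.
case: s' => [|i s'] /=.
  by rewrite big1 ?addr0// => i _; rewrite mulr0 mul0r.
rewrite mul0r add0r IH mulrCA mulr_sumr mulr_sumr; apply: eq_bigr => p _.
by rewrite !mulrA.
Qed.

Definition walk_series (k : nat) : fps S := fun j => walk j (k, [::]).

(** First-step decomposition. After a push, the part above the cell [k] and the part from its return
    on multiply. *)
Lemma walk_seriesE k : walk_series k = fpsC (m k) + fpsX S * walk_series k.+1 +
  fpsC t * (fpsX S * (fpsX S * (walk_series 0%N * walk_series k))).
Proof.
apply/funext => -[|j]; rewrite !fpsDE fpsCM !fpsXM; first by rewrite mulr0 !addr0.
rewrite {1}/walk_series/= mulr0 addr0 add0r; congr (_ + _).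
rewrite (walk_split j 0 [::]); congr (_ * _); case: j => [|j]; first by rewrite big_ord0.
by rewrite fpsME; apply: eq_bigr => i _; rewrite subSS.
Qed.

End walks.

Lemma walk_morph (S S' : comNzRingType) (f : {rmorphism S -> S'}) m t j u :
  f (walk m t j u) = walk (f \o m) (f t) j u.
Proof.
elim: j u => [|j IH] [k s] /=; first by case: s; rewrite ?rmorph0.
rewrite !rmorphD/= !IH rmorphM/=; congr (_ + _ * _).
by case: s => [|i s]; rewrite ?rmorph0// rmorphM/= IH.
Qed.

(** A weight [s] per cell shares the factor [s ^+ 2] of a pop between the push and the pop. Each
    step then multiplies the bound by at most [C + s + s], one term per kind of step. *)
Lemma walk_bound (R : realFieldType) (m : nat -> R) (C s : R) j u :
  0 <= C -> 0 <= s -> (forall k, `|m k| <= C ^+ k) ->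
  `|walk m (s ^+ 2) j u| <=
    (C + s *+ 2) ^+ j * (C ^+ (u.1 + sumn u.2) * s ^+ size u.2).
Proof.
move=> C0 s0 mC; elim: j u => [|j IH] [k l] /=.
  rewrite mul1r; case: l => [|i l] /=; first by rewrite addn0 mulr1.
  by rewrite normr0 mulr_ge0 ?exprn_ge0.
set K := C + s *+ 2; set W := C ^+ _ * _.
have -> : K ^+ j.+1 * W = K ^+ j * (C * W) + K ^+ j * (s * W) + K ^+ j * (s * W).
  by rewrite exprS /K; ring.
rewrite (le_trans (ler_normD _ _))// lerD//.
  rewrite (le_trans (ler_normD _ _))// lerD//.
    by rewrite (le_trans (IH _))//= addSn exprS /W -mulrA.
  by rewrite (le_trans (IH _))//= add0n exprS /W [_ * (s * _)]mulrCA.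
case: l @W => [|i l] W; first by rewrite mulr0 normr0 !mulr_ge0 ?exprn_ge0// addr_ge0// mulrn_wge0.
rewrite !normrM ger0_norm ?exprn_ge0//.
have -> : K ^+ j * (s * W) = s ^+ 2 * (C ^+ k * (K ^+ j * (C ^+ (i + sumn l) * s ^+ size l))).
  by rewrite /W /= exprD !exprS; ring.
apply: ler_wpM2l; first by rewrite mulr_ge0.
by apply: ler_pM => //; exact: (IH (i, l)).
Qed.

(** * Time derivative of the walk series *)

Section heat_equation.
Variables (R : comNzRingType) (m : nat -> R).

Let E := walk_series (fun k => (m k)%:P) 'X.
Let X := @fpsX {poly R}.

(** The derivative in [t] marks a push with its matching pop. The stretch between them is counted by
    [E 0]; removing it leaves a walk of some length [j] and one of its [j + 1] positions, whence
    [E k + euler (E k)]. *)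
Lemma walk_series_deriv k :
  fps_deriv (E k) = X * X * E 0%N * (E k + euler (E k)).
Proof.
pose D k := fps_deriv (E k) - X * X * E 0%N * (E k + euler (E k)).
(* The defect solves a homogeneous linear system whose right-hand side only involves coefficients of
   lower order. *)
have DE k' : D k' = X * D k'.+1 + fpsC 'X * (X * (X * (D 0%N * E k' + E 0%N * D k'))).
  have eE := walk_seriesE (fun k => (m k)%:P) 'X k'.
  rewrite -/(E k'.+1) -/(E k') -/(E 0%N) -/X in eE.
  have C0 : fpsC (0 : {poly R}) = 0 by apply/funext => -[].
  have C1 : fpsC (1 : {poly R}) = 1 by apply/funext => -[].
  have dE : fps_deriv (E k') = X * fps_deriv (E k'.+1) + X * X * E 0%N * E k' +
      fpsC 'X * X * X * (fps_deriv (E 0%N) * E k' + E 0%N * fps_deriv (E k')).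
    rewrite {1}eE !fps_derivD !fps_derivM !fps_deriv_fpsC fps_derivX derivC derivX.
    by rewrite C0 C1; ring.
  have uE : euler (E k') = X * E k'.+1 + X * euler (E k'.+1) + fpsC 'X * X * X *
      (E 0%N * E k' + E 0%N * E k' + euler (E 0%N) * E k' + E 0%N * euler (E k')).
    by rewrite {1}eE !eulerD !eulerM !euler_fpsC euler_fpsX -/X; ring.
  by rewrite /D {1}dE {1}uE; ring.
suff D0 k' : D k' = 0 by apply/eqP; rewrite -subr_eq0 -/(D k) D0.
apply/funext => n; elim/ltn_ind: n k' => n IH k'.
rewrite DE fpsDE fpsCM fpsX2M fpsXM.
case: n IH => [|n] IH; first by rewrite mulr0 addr0.
rewrite IH// add0r; case: n IH => [|n] IH; first by rewrite mulr0.
rewrite fpsDE !fpsME !big1 ?addr0 ?mulr0// => i _; rewrite IH ?mulr0 ?mul0r//.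
  by have := ltn_ord i; lia.
by have := ltn_ord i; lia.
Qed.

Lemma walk_series_heat :
  fps_deriv (E 0%N) *+ 2 = euler (X * X * (E 0%N * E 0%N)).
Proof.
by rewrite walk_series_deriv !eulerM euler_fpsX -/X; ring.
Qed.

End heat_equation.

(** * Convergence of solutions of the moment equations *)

Section poly_cvg.
Variable R : realType.
Implicit Types p q : {poly R}.

Definition poly_cvg (p_ : nat -> {poly R}) p := exists N, [/\ (forall n, (size (p_ n) <= N)%N),
  (size p <= N)%N & forall i, (p_ n)`_i @[n --> \oo] --> p`_i].

Lemma poly_cvgD (p_ q_ : nat -> {poly R}) p q : poly_cvg p_ p -> poly_cvg q_ q ->
  poly_cvg (fun n => p_ n + q_ n) (p + q).
Proof.
move=> [N [pN pN' pc]] [L [qL qL' qc]]; exists (maxn N L); split.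
- move=> n; rewrite (leq_trans (size_polyD _ _))// geq_max !leq_max pN qL orbT//.
- by rewrite (leq_trans (size_polyD _ _))// geq_max !leq_max pN' qL' orbT.
- move=> i; rewrite coefD; under eq_fun do rewrite coefD.
  exact: cvgD.
Qed.

Lemma poly_cvg0 : poly_cvg (fun=> 0) 0.
Proof. by exists 0; split => [n||i]; rewrite ?size_poly0//; exact: cvg_cst. Qed.

Lemma poly_cvg_sum (I : Type) (s : seq I) (p_ : I -> nat -> {poly R}) (p : I -> {poly R}) :
  (forall i, poly_cvg (p_ i) (p i)) ->
  poly_cvg (fun n => \sum_(i <- s) p_ i n) (\sum_(i <- s) p i).
Proof.
move=> pc; elim: s => [|i s IH].
  rewrite big_nil; under eq_fun do rewrite big_nil; exact: poly_cvg0.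
rewrite big_cons; under eq_fun do rewrite big_cons; exact: poly_cvgD.
Qed.

Lemma cvg_big_sum (I : Type) (s : seq I) (f : I -> nat -> R) (l : I -> R) :
  (forall i, f i n @[n --> \oo] --> l i) ->
  \sum_(i <- s) f i n @[n --> \oo] --> \sum_(i <- s) l i.
Proof.
move=> fl; elim: s => [|i s IH].
  rewrite big_nil; under eq_fun do rewrite big_nil; exact: cvg_cst.
rewrite big_cons; under eq_fun do rewrite big_cons; exact: cvgD.
Qed.

Lemma poly_cvgM (p_ q_ : nat -> {poly R}) p q : poly_cvg p_ p -> poly_cvg q_ q ->
  poly_cvg (fun n => p_ n * q_ n) (p * q).
Proof.
move=> [N [pN pN' pc]] [L [qL qL' qc]]; exists (N + L)%N; split.
- move=> n; rewrite (leq_trans (size_polyMleq _ _))//.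
  by rewrite (leq_trans (leq_pred _))// leq_add.
- rewrite (leq_trans (size_polyMleq _ _))//.
  by rewrite (leq_trans (leq_pred _))// leq_add.
- move=> i; rewrite coefM; under eq_fun do rewrite coefM.
  by apply: cvg_big_sum => j; exact: cvgM.
Qed.

Lemma poly_cvgC (a_ : nat -> R) (a : R) : a_ n @[n --> \oo] --> a ->
  poly_cvg (fun n => (a_ n)%:P) a%:P.
Proof.
move=> ac; exists 1%N; split => [n||i]; rewrite ?size_polyC ?leq_b1//.
rewrite coefC; under eq_fun do rewrite coefC.
by case: i => [|i] //=; exact: cvg_cst.
Qed.

Lemma poly_cvgMn (p_ : nat -> {poly R}) p k : poly_cvg p_ p ->
  poly_cvg (fun n => p_ n *+ k) (p *+ k).
Proof.
move=> pc; elim: k => [|k IH].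
  by rewrite mulr0n; under eq_fun do rewrite mulr0n; exact: poly_cvg0.
by rewrite mulrS; under eq_fun do rewrite mulrS; exact: poly_cvgD.
Qed.

Lemma poly_cvg_horner (p_ : nat -> {poly R}) p (t : R) : poly_cvg p_ p ->
  (p_ n).[t] @[n --> \oo] --> p.[t].
Proof.
move=> [N [pN pN' pc]]; rewrite (horner_coef_wide _ pN').
under eq_fun => n do rewrite (horner_coef_wide _ (pN n)).
apply: cvg_big_sum => i; apply: cvgM; [exact: pc|exact: cvg_cst].
Qed.

Lemma poly_cvg_antideriv (p_ : nat -> {poly R}) p (a : R) : a != 0 ->
  poly_cvg (fun n => a *: (p_ n)^`()) (a *: p^`()) ->
  (p_ n).[0] @[n --> \oo] --> p.[0] -> poly_cvg p_ p.
Proof.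
move=> a0 [N [pN pN' pc]] p0; exists N.+1.
have szd q : (size (a *: q^`()) <= N)%N -> (size q <= N.+1)%N.
  move=> qN; apply/leq_sizeP => -[//|j] Nj.
  have /leq_sizeP/(_ j Nj)/eqP := qN.
  rewrite coefZ coef_deriv mulf_eq0 (negbTE a0)/= mulrn_eq0/=.
  by move/eqP.
split => [n||]; [exact: szd|exact: szd|case=> [|i]].
  by rewrite -horner_coef0; under eq_fun do rewrite -horner_coef0.
have E q : q`_i.+1 = (a * i.+1%:R)^-1 * (a *: q^`())`_i.
  rewrite coefZ coef_deriv -[q`_i.+1 *+ _]mulr_natl [a * (_ * _)]mulrA mulKf//.
  by rewrite mulf_neq0// pnatr_eq0.
rewrite E; under eq_fun do rewrite E.
by apply: cvgM; [exact: cvg_cst|exact: pc].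
Qed.

Lemma fps_heat_cvg (M_ : nat -> fps {poly R}) (M : fps {poly R}) (d : nat -> R) :
  d n @[n --> \oo] --> 0 ->
  (forall n, fps_deriv (M_ n) *+ 2 = euler (fpsX _ * fpsX _ *
     (M_ n * M_ n - fpsC (d n)%:P * (euler (M_ n) + M_ n)))) ->
  fps_deriv M *+ 2 = euler (fpsX _ * fpsX _ * (M * M)) ->
  (forall k, (M_ n k).[0] @[n --> \oo] --> (M k).[0]) ->
  forall k t, (M_ n k).[t] @[n --> \oo] --> (M k).[t].
Proof.
move=> d0 Mn' M' M0 k t; apply: poly_cvg_horner.
elim/ltn_ind: k => k IH; apply: (@poly_cvg_antideriv _ _ 2) => //.
have E (f : fps {poly R}) : 2 *: (f k)^`() = (fps_deriv f *+ 2) k.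
  by rewrite fpsMnE scaler_nat.
rewrite E M'; under eq_fun => n do rewrite E Mn'.
rewrite /euler -mulrA fpsX2M; under eq_fun => n do rewrite -mulrA fpsX2M.
(* Moments of order 0 and 1 are constant in time; those of order [k.+2] are driven by orders up to
   [k]. *)
apply: poly_cvgMn; case: k IH {E} => [|[|k]] IH; [exact: poly_cvg0..|].
rewrite -[_ k]addr0; under eq_fun => n do rewrite fpsDE fpsNE fpsCM.
apply: poly_cvgD.
  rewrite fpsME; under eq_fun => n do rewrite fpsME.
  apply: poly_cvg_sum => i; apply: poly_cvgM; apply: IH; have := ltn_ord i; lia.
rewrite -[0](mul0r (- (euler M k + M k))) -polyC0.
under eq_fun => n do rewrite -mulrN.
apply: poly_cvgM; first exact: poly_cvgC.
rewrite -mulN1r; under eq_fun => n do rewrite -mulN1r.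
apply: poly_cvgM; first by rewrite -polyC1 -polyCN; apply: poly_cvgC; exact: cvg_cst.
by apply: poly_cvgD; [apply: poly_cvgMn|]; apply: IH.
Qed.

End poly_cvg.

(** * Real-rootedness of the heat flow *)

Section real_rooted.
Local Open Scope complex_scope.
Variable R : realType.
Implicit Types (p q : {poly R}) (xs : seq R) (z : R[i]).
Local Notation toC := (map_poly (real_complex R)).
Local Notation lin xs := (\prod_(x <- xs) ('X - x%:P)).

Lemma only_real_roots_split p : only_real_roots p ->
  exists xs, p = lead_coef p *: lin xs.
Proof.
move=> rp; have [zs pzs] := closed_field_poly_normal (toC p).
have [->|p0] := eqVneq p 0; first by exists [::]; rewrite lead_coef0 scale0r.
exists [seq complex.Re z | z <- zs]; apply: (map_poly_inj (real_complex R)).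
rewrite pzs lead_coef_map linearZ/= rmorph_prod big_map; congr (_ *: _).
rewrite big_seq [RHS]big_seq; apply: eq_bigr => z zzs.
have /rp z0 : root (toC p) z.
  rewrite pzs lead_coef_map rootZ ?fmorph_eq0 ?lead_coef_eq0//.
  by rewrite root_prod_XsubC.
rewrite rmorphB/= map_polyX map_polyC/=; congr (_ - _%:P).
by move: z0; case: (z) => a b /= ->.
Qed.

Fact XsubC_split z (x : R) : z - x%:C = (complex.Re z - x) +i* complex.Im z.
Proof. by case: z => a b; apply/eqP; rewrite eq_complex/= oppr0 addr0 !eqxx. Qed.

(* [Im (p'(z) / p(z))] and [Im z] have opposite signs. *)
Lemma im_log_deriv_lin xs z (p := lin xs) (P := (toC p).[z]) (P' := (toC p^`()).[z]) :
  complex.Im z * (complex.Im P' * complex.Re P - complex.Re P' * complex.Im P) <= 0.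
Proof.
rewrite /P /P' /p {p P P'}; elim: xs => [|x xs IH].
  by rewrite big_nil derivC rmorph0 horner0/= !mul0r subrr mulr0.
rewrite big_cons derivM derivXsubC mul1r rmorphM/= rmorphB/= map_polyX map_polyC/=.
rewrite rmorphD rmorphM rmorphB/= map_polyX map_polyC/= hornerD !hornerM !hornerXsubC.
move: IH; set P := (toC _).[z]; set P' := (toC _).[z]; clearbody P P'.
rewrite XsubC_split.
move: (complex.Re z) (complex.Im z) => a b; case: P P' => u v [u' v'] /= IH.
(* Logarithmic derivatives add up: after clearing denominators, the first term comes from
   [1 / (z - x)] and the second from the remaining factors. *)
set y := _ * _; have -> : y = - (b ^+ 2 * (u' ^+ 2 + v' ^+ 2)) +
    ((a - x) ^+ 2 + b ^+ 2) * (b * (v * u' - u * v')) by rewrite /y; ring.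
rewrite -[leRHS]addr0 lerD//.
  by rewrite oppr_le0 mulr_ge0 ?addr_ge0 ?sqr_ge0.
by rewrite mulr_ge0_le0// addr_ge0 ?sqr_ge0.
Qed.

Lemma im_log_deriv p z (P := (toC p).[z]) (P' := (toC p^`()).[z]) :
  only_real_roots p ->
  complex.Im z * (complex.Im P' * complex.Re P - complex.Re P' * complex.Im P) <= 0.
Proof.
rewrite /P /P' => {P P'} /only_real_roots_split[xs ->]; set l := lead_coef p.
have ReZ w : complex.Re (l%:C * w) = l * complex.Re w.
  by case: w => a b; rewrite /= mul0r subr0.
have ImZ w : complex.Im (l%:C * w) = l * complex.Im w.
  by case: w => a b; rewrite /= mul0r addr0.
rewrite derivZ !map_polyZ/= !hornerZ !ReZ !ImZ; have d0 := im_log_deriv_lin xs z; cbv zeta in d0; move: d0.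
set d := _ * (_ - _) => d0; rewrite [leLHS](_ : _ = l ^+ 2 * d); last by rewrite /d; ring.
by rewrite mulr_ge0_le0// sqr_ge0.
Qed.

Lemma heat_flow_sum t p N : (size p <= N)%N ->
  heat_flow t p = \sum_(m < N) ((t / 2) ^+ m / m`!%:R) *: p^`(m.*2).
Proof.
move=> pN; rewrite /heat_flow.
rewrite -!(big_mkord xpredT (fun m => ((t / 2) ^+ m / m`!%:R) *: p^`(m.*2))).
rewrite [RHS](big_cat_nat (n := size p))//=.
rewrite [X in _ = _ + X]big_nat_cond [X in _ = _ + X]big1 ?addr0// => m.
rewrite andbT => /andP[pm _]; rewrite derivn_poly0 ?scaler0// -addnn.
by rewrite (leq_trans pm)// leq_addr.
Qed.

Lemma derivn_XsubC_mul q x m :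
  (('X - x%:P) * q)^`(m.+1) = ('X - x%:P) * q^`(m.+1) + q^`(m) *+ m.+1.
Proof.
elim: m => [|m IH].
  by rewrite !derivn1 derivM derivXsubC mul1r addrC derivn0.
rewrite derivnS IH derivD derivM derivXsubC mul1r -!derivnS derivMn -derivnS.
by rewrite [in RHS]mulrS; ring.
Qed.

(** The flow conjugates multiplication by [X] into [X + t d/dz]. Termwise, the Leibniz factor
    [2 (m + 1)] turns [(t / 2)^(m + 1) / (m + 1)!] into [t (t / 2)^m / m!]. *)
Lemma heat_flow_XsubC_mul t q x :
  heat_flow t (('X - x%:P) * q) =
  ('X - x%:P) * heat_flow t q + t *: (heat_flow t q)^`().
Proof.
pose N := (size q).+1; pose f m : R := (t / 2) ^+ m / m`!%:R.
have sN : (size (('X - x%:P) * q)%R <= N.+1)%N.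
  by rewrite (leq_trans (size_polyMleq _ _))// size_XsubC.
rewrite (heat_flow_sum t sN).
rewrite (@heat_flow_sum t q N); last exact: leqnSn.
rewrite -[X in _ = _ * X + _](@heat_flow_sum t q N); last exact: leqnSn.
rewrite (@heat_flow_sum t q N.+1); last by rewrite /N; lia.
rewrite [in RHS]raddf_sum/= mulr_sumr scaler_sumr big_ord_recl.
rewrite [X in _ = X + _]big_ord_recl -[RHS]addrA.
congr (_ + _); first by rewrite !derivn0 scalerAr.
rewrite -big_split; apply: eq_bigr => m _.
rewrite lift0 doubleS derivn_XsubC_mul scalerDr scalerAr.
congr (_ + _); rewrite derivZ -derivnS -!scalerMnr scalerMnl !scalerA.
congr (_ *: _); rewrite -[LHS]mulr_natr factS natrM invfM exprS.
have m0 : m`!%:R != 0 :> R by rewrite pnatr_eq0 -lt0n fact_gt0.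
have m1 : m.+1%:R != 0 :> R by rewrite pnatr_eq0.
rewrite (_ : m.*2.+2 = 2 * m.+1)%N; last by lia.
rewrite natrM; move: m0 m1; move: (_`!%:R) (_.+1%:R) => b a b0 a0.
by field; rewrite a0 b0.
Qed.

(* If [Q] is the flow of [q], the flow of [(X - x) q] is [(X - x) Q + t Q'], and
   at a nonreal [z] the numbers [z - x] and [t (Q'/Q)(z)] lie on the same side of
   the real axis. *)
Lemma heat_flow_lin_real_rooted t xs : t <= 0 -> only_real_roots (heat_flow t (lin xs)).
Proof.
move=> t0; elim: xs => [|x xs IH].
  rewrite big_nil /heat_flow size_poly1 big_ord1 fact0 divr1 expr0 scale1r derivn0.
  by move=> z; rewrite rmorph1 (negbTE (root1 z)).
rewrite big_cons heat_flow_XsubC_mul; set Q := heat_flow _ _ in IH *.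
have Q0 : Q != 0.
  apply/eqP => Q0; have /IH/eqP : root (toC Q) (0 +i* 1) by rewrite Q0 rmorph0 root0.
  by rewrite /= oner_eq0.
move=> z; have [->//|z0] := eqVneq (complex.Im z) 0.
have nQ : (toC Q).[z] != 0 by apply: contra z0 => /IH ->.
have lQ := im_log_deriv z IH; cbv zeta in lQ; move: lQ.
rewrite /root rmorphD rmorphM rmorphB/= map_polyX map_polyC/= map_polyZ/=.
rewrite hornerD hornerM hornerXsubC hornerZ XsubC_split.
move: nQ z0; move: (toC Q).[z] (toC Q^`()).[z] (complex.Re z) (complex.Im z).
case=> u v [u' v'] a b /= uv0 b0 H /eqP[/= e1 e2]; exfalso.
(* The equation at a zero, multiplied by the conjugate of [Q(z)]: this is [Im z] times its imaginary
   part. Both summands are nonnegative, as [t <= 0]. *)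
have e : b ^+ 2 * (u ^+ 2 + v ^+ 2) + t * (b * (v' * u - u' * v)) = 0.
  rewrite (_ : _ + _ = b * (u * ((a - x) * v + b * u + (t * v' + 0 * u')) -
    v * ((a - x) * u - b * v + (t * u' - 0 * v')))); last by ring.
  by rewrite e1 e2 !mulr0 subrr mulr0.
have : b ^+ 2 * (u ^+ 2 + v ^+ 2) <= 0.
  by rewrite -e lerDl mulr_le0.
rewrite pmulr_rle0 ?exprn_even_gt0// => uv.
have : u ^+ 2 + v ^+ 2 == 0 by rewrite eq_le uv addr_ge0 ?sqr_ge0.
rewrite paddr_eq0 ?sqr_ge0// !sqrf_eq0 => /andP[/eqP u0 /eqP v0].
by move/negP: uv0; apply; rewrite u0 v0.
Qed.

Lemma mup_lin x xs : mup x (lin xs) = count_mem x xs.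
Proof.
elim: xs => [|y xs IH]; first by rewrite big_nil mupNroot// root1.
rewrite big_cons mupM ?polyXsubC_eq0 ?monic_neq0 ?monic_prod_XsubC//.
  by rewrite IH -[X in mup _ X]expr1 mup_XsubCX/=; case: (y == x).
Qed.

Lemma real_roots_perm a xs : a != 0 -> perm_eq (real_roots (a *: lin xs)) xs.
Proof.
move=> a0; set p := a *: _.
have p0 : p != 0 by rewrite scaler_eq0 negb_or a0 monic_neq0 ?monic_prod_XsubC.
have mp x : mup x p = count_mem x xs.
  by rewrite /p -mul_polyC mupMr ?mup_lin// rootC.
apply/allP => x _ /=; apply/eqP.
have cr : forall s : seq R, uniq s ->
    count_mem x (flatten [seq nseq (mup y p) y | y <- s]) =
    (if x \in s then mup x p else 0%N).
  elim=> //= y s IH /andP[ys us]; rewrite count_cat IH// count_nseq/= in_cons.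
  have [->|xy] := eqVneq x y; last by rewrite /= ?mul0n.
  by rewrite (negbTE ys) mul1n addn0.
rewrite cr ?uniq_roots// mp.
case: ifPn => // xr; apply/esym/count_memPn; apply: contra xr => xxs.
by rewrite -roots_on_rootsR// /root /p hornerZ mulf_eq0 -/(root _ _) root_prod_XsubC xxs orbT.
Qed.

Lemma heat_flowZ t a p : heat_flow t (a *: p) = a *: heat_flow t p.
Proof.
rewrite (@heat_flow_sum t _ (size p)) ?size_scale_leq// scaler_sumr.
by apply: eq_bigr => m _; rewrite derivnZ !scalerA; congr (_ *: _); exact: mulrC.
Qed.

Lemma heat_flow_lin t xs : t <= 0 ->
  exists2 ys, size ys = size xs & heat_flow t (lin xs) = lin ys.
Proof.
move=> t0; have [ys hy] := only_real_roots_split (heat_flow_lin_real_rooted (xs := xs) t0).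
set q := lin xs in hy *; set p := heat_flow t q in hy *.
have sq : size q = (size xs).+1 by exact: size_prod_XsubC.
have mq : q \is monic by exact: monic_prod_XsubC.
have hp : p = q + (p - q) by rewrite addrC subrK.
(* The terms of the flow after the first have lower degree, so degree and leading coefficient
   persist. *)
have spq : (size (p - q)%R < size q)%N.
  rewrite /p /heat_flow sq big_ord_recl expr0 fact0 divr1 scale1r derivn0 addrAC subrr add0r.
  rewrite ltnS (leq_trans (size_sum _ _ _))//; apply/bigmax_leqP => i _.
  rewrite (leq_trans (size_scale_leq _ _))// lift0 doubleS; apply/leq_sizeP => j xj.
  by rewrite coef_derivn nth_default ?mul0rn// sq; lia.
have sp : size p = (size xs).+1 by rewrite hp size_polyDl.
have lp : lead_coef p = 1 by rewrite hp lead_coefDl// (monicP mq).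
move: hy; rewrite lp scale1r => hy; exists ys => //.
by move: sp; rewrite hy size_prod_XsubC => -[].
Qed.


End real_rooted.

(** * Integrals of continuous functions *)

Section supported_measures.
Variable R : realType.

Lemma continuous_bounded_itv (f : R -> R) (a b : R) : continuous f ->
  exists2 M, 0 <= M & forall x, x \in `[a, b] -> `|f x| <= M.
Proof.
move=> cf; have [ab|ba] := leP a b; last first.
  exists 0 => // x; rewrite in_itv/= => /andP[ax xb].
  by have := lt_le_trans ba (le_trans ax xb); rewrite ltxx.
have cnf : {within `[a, b], continuous (fun x => `|f x|)}.
  apply: continuous_subspaceT => x.
  by apply: (continuous_comp (cf x)); exact: norm_continuous.
have [c cab fc] := EVT_max ab cnf.
by exists `|f c|.
Qed.

Variables (m : {finite_measure set (measurableTypeR R) -> \bar R}) (a b : R).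
Hypothesis ms : m (~` [set` `[a, b]]) = 0%E.

Lemma supported_integrable (f : R -> R) : continuous f ->
  m.-integrable setT (EFin \o f).
Proof.
move=> cf; have mf : measurable_fun [set: measurableTypeR R] f.
  exact: continuous_measurable_fun.
apply/(@negligible_integrable _ _ _ m setT (~` [set` `[a, b]])) => //.
  exact: measurableC.
  exact/measurable_EFinP.
rewrite setTD setCK; apply: measurable_bounded_integrable => //.
- by have := fin_num_measure m [set` `[a, b]] (measurable_itv _); rewrite ge0_fin_numE.
- exact: measurable_funTS.
- have [M M0 fM] := continuous_bounded_itv a b cf.
  exists M; split; first exact: num_real.
  by move=> x Mx y /= yab; rewrite (le_trans (fM _ yab))// ltW.
Qed.

Lemma supported_Rintegral (f : R -> R) : continuous f ->
  (\int[m]_x f x)%R = (\int[m]_(x in `[a, b]) f x)%R.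
Proof.
move=> cf; rewrite /Rintegral; congr fine.
have mN : measurable (~` [set` `[a, b]] : set (measurableTypeR R)) by exact: measurableC.
have := @negligible_integral _ _ _ m setT _ _ mN measurableT (supported_integrable cf) ms.
by rewrite setTD setCK.
Qed.

End supported_measures.

(** * Integrals against empirical root measures *)

Section empirical.
Variables (R : realType) (p : {poly R}).

Lemma ge0_integral_empirical_roots (g : R -> R) :
  measurable_fun [set: measurableTypeR R] g -> (forall x, 0 <= g x) ->
  (\int[empirical_roots p]_x (g x)%:E)%E =
  ((size p).-1%:R^-1 * \sum_(y <- real_roots p) g y)%:E.
Proof.
move=> mg g0; have mg' : measurable_fun [set: measurableTypeR R] (EFin \o g).
  exact/measurable_EFinP.
have g0' x : (0 <= (g x)%:E)%E by rewrite lee_fin.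
rewrite ge0_integral_mscale//= ?ge0_integral_measure_sum//.
rewrite EFinM; congr (_ * _)%E.
rewrite (big_nth 0) big_mkord -sumEFin; apply: eq_bigr => i _.
by rewrite integral_dirac// diracT mul1e.
Qed.

Lemma Rintegral_empirical_roots (f : R -> R) : continuous f ->
  (\int[empirical_roots p]_x f x)%R =
  (size p).-1%:R^-1 * \sum_(y <- real_roots p) f y.
Proof.
move=> cf; have mf : measurable_fun [set: measurableTypeR R] f.
  exact: continuous_measurable_fun.
rewrite /Rintegral integralE.
rewrite (_ : (fun x => (f x)%:E)^\+%E = EFin \o f^\+); last first.
  by apply/funext => x; rewrite funeposE /funrpos/= EFin_max.
rewrite (_ : (fun x => (f x)%:E)^\-%E = EFin \o f^\-); last first.
  by apply/funext => x; rewrite funenegE /funrneg/= EFin_max.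
rewrite !ge0_integral_empirical_roots//; last 2 first.
- exact: measurable_funrneg.
- exact: measurable_funrpos.
rewrite -EFinB/= -mulrBr -sumrB; congr (_ * _).
by apply: eq_bigr => y _; rewrite -[in RHS](funrposBneg f).
Qed.

End empirical.

(** * Chebyshev polynomials and the semicircle distribution *)

Section chebyshev.
Variable K : comNzRingType.

(** Chebyshev polynomials of the second kind in the form [U_n(X / 2)], orthonormal for the
    semicircle law on [[-2, 2]]. *)
Fixpoint cheb n : {poly K} :=
  if n is n1.+1 then if n1 is n2.+1 then 'X * cheb n1 - cheb n2 else 'X else 1.

Lemma cheb_rec n : 'X * cheb n.+1 = cheb n.+2 + cheb n.
Proof. by rewrite /= subrK. Qed.
Lemma cheb0 : cheb 0 = 1. Proof. by []. Qed.
Lemma cheb1 : cheb 1 = 'X. Proof. by []. Qed.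
Local Arguments cheb : simpl never.

(** The recurrence writes ['X^n] as a sum of Chebyshev polynomials without scalars, so additivity of
    [f] and [g] suffices. *)
Lemma cheb_span (V : zmodType) (f g : {poly K} -> V) :
  {morph f : p q / p + q} -> {morph g : p q / p + q} ->
  (forall n, f (cheb n) = g (cheb n)) -> forall n, f 'X^n = g 'X^n.
Proof.
move=> fD gD fg n; suff H : forall k, f ('X^n * cheb k) = g ('X^n * cheb k).
  by have := H 0%N; rewrite mulr1.
elim: n => [|n IH] k; first by rewrite mul1r.
rewrite exprSr -mulrA; case: k => [|k].
  by have := IH 1%N; rewrite mulr1.
by rewrite cheb_rec mulrDr fD gD !IH.
Qed.

End chebyshev.
Arguments cheb : simpl never.

Lemma map_cheb (K K' : comNzRingType) (h : {rmorphism K -> K'}) n :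
  map_poly h (cheb K n) = cheb K' n.
Proof.
suff: map_poly h (cheb K n) = cheb K' n /\ map_poly h (cheb K n.+1) = cheb K' n.+1.
  by case.
elim: n => [|n [IH1 IH2]]; first by rewrite !cheb0 !cheb1 rmorph1 map_polyX.
split => //; rewrite -[cheb K n.+2](addrK (cheb K n)) -cheb_rec.
by rewrite rmorphB rmorphM/= map_polyX IH1 IH2.
Qed.

(** * Chebyshev polynomials of the semicircular element *)

Section fock_chebyshev.
Variables (K : fieldType) (m : nat -> K).
Hypothesis m0 : m 0%N = 1.

(** The three-term recurrence is the action of [push + pop] on the iterates of [pop] at the vacuum,
    where [push] removes one [pop]. *)
Lemma horner_semicircular_cheb n :
  horner_alg (semicircular m) (cheb K n) (vacuum m) = ((pop m) ^+ n) (vacuum m).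
Proof.
suff: horner_alg (semicircular m) (cheb K n) (vacuum m) = ((pop m) ^+ n) (vacuum m) /\
  horner_alg (semicircular m) (cheb K n.+1) (vacuum m) = ((pop m) ^+ n.+1) (vacuum m).
  by case.
elim: n => [|n [IH1 IH2]].
  rewrite cheb0 cheb1 rmorph1; split => //.
  rewrite horner_algX /semicircular endo_addE push_vacuum add0r.
  by rewrite expr1.
split => //.
rewrite -[cheb K n.+2](addrK (cheb K n)) -cheb_rec horner_algD -['X * _]addr0 -polyC0.
rewrite endo_addE [in 'X * _]mulrC endo_horner_MXaddC scale0r addr0 IH2.
have -> : horner_alg (semicircular m) (- cheb K n) (vacuum m) =
  - (horner_alg (semicircular m) (cheb K n) (vacuum m)) by rewrite raddfN.
rewrite IH1 /semicircular endo_addE endo_expS push_pop// addrAC subrr add0r.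
by rewrite -!endo_expS.
Qed.

Lemma fock_ev_cheb n :
  fock_ev m (horner_alg (semicircular m) (cheb K n)) = (n == 0%N)%:R.
Proof.
rewrite /fock_ev horner_semicircular_cheb; case: n => [|n]; first exact: m0.
by rewrite endo_expS.
Qed.

End fock_chebyshev.

(** * Orthogonality of sines on [[0, pi]] *)

Section trigonometric_integrals.
Variable R : realType.
Local Notation mu := (@lebesgue_measure R).

Lemma sin_cheb n (t : R) : sin t * (cheb R n).[2 * cos t] = sin (n.+1%:R * t).
Proof.
suff: sin t * (cheb R n).[2 * cos t] = sin (n.+1%:R * t) /\
  sin t * (cheb R n.+1).[2 * cos t] = sin (n.+2%:R * t) by case.
elim: n => [|n [IH1 IH2]].
  rewrite cheb0 cheb1 -polyC1 hornerC hornerX mulr1 mul1r; split => //.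
  by rewrite [in RHS]mulr_natl [in RHS]mulr2n sinD; ring.
split => //; rewrite -[cheb R n.+2](addrK (cheb R n)) -cheb_rec.
rewrite hornerD hornerN hornerM hornerX mulrBr mulrCA IH2 IH1.
have -> : n.+3%:R * t = n.+2%:R * t + t by rewrite -[n.+3]addn1 natrD mulrDl mul1r.
have -> : n.+1%:R * t = n.+2%:R * t - t by rewrite -[n.+2]addn1 natrD; ring.
by rewrite sinB sinD; ring.
Qed.

Lemma is_derive_sin_mul (c t : R) : is_derive t 1 (fun t => sin (c * t)) (c * cos (c * t)).
Proof.
rewrite mulrC; apply: (@is_derive1_comp R sin (fun t => c * t)).
have := @is_deriveZ R R R id c t 1 1 (is_derive_id _ _).
by rewrite /GRing.scale/= mulr1.
Qed.

Lemma is_derive_lin2 (f g : R -> R) (a b df dg t : R) :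
  is_derive t 1 f df -> is_derive t 1 g dg ->
  is_derive t 1 (fun t => a * f t + b * g t) (a * df + b * dg).
Proof.
move=> fd gd; have af := @is_deriveZ R R R f a t 1 df fd.
have bg := @is_deriveZ R R R g b t 1 dg gd.
exact: (@is_deriveD R R R _ _ t 1 _ _ af bg).
Qed.

Lemma continuous_sin_mul (c : R) : continuous (fun t : R => sin (c * t)).
Proof.
move=> t; apply: (continuous_comp (g := sin)); last exact: continuous_sin.
exact: mulrl_continuous.
Qed.

Lemma integral_sin_mul_sin n :
  (\int[mu]_(t in `[0%R, pi]) (sin (n.+1%:R * t) * sin t)%:E)%E =
  ((n == 0%N)%:R * (pi / 2))%:E.
Proof.
have cS : continuous (fun t : R => sin (n.+1%:R * t) * sin t).
  by move=> t; apply: cvgM; [exact: continuous_sin_mul|exact: continuous_sin].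
have FTC (G : R -> R) : (forall t : R, is_derive t 1 G (sin (n.+1%:R * t) * sin t)) ->
    (\int[mu]_(t in `[0%R, pi]) (sin (n.+1%:R * t) * sin t)%:E)%E = (G pi - G 0)%:E.
  move=> dG; have cG : continuous G.
    by move=> t; apply/differentiable_continuous/derivable1_diffP; exact: ex_derive.
  rewrite (@continuous_FTC2 _ _ G) ?pi_gt0//.
  - exact: continuous_subspaceT.
  - split => [t _||]; [exact: ex_derive|exact/cvg_at_right_filter/cG|].
    exact/cvg_at_left_filter/cG.
  - by move=> t _; rewrite derive1E; exact: derive_val.
have sinN j : sin (j%:R * pi) = 0 :> R.
  elim: j => [|j IH]; first by rewrite mul0r sin0.
  by rewrite -natr1 mulrDl mul1r sinD IH sinpi mulr0 mul0r addr0.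
case: n FTC {cS} => [|n] FTC.
  have D (t : R) : is_derive t 1 (fun t => 2^-1 * t + (- 4^-1) * sin (2 * t)) (sin (1 * t) * sin t).
    have := is_derive_lin2 2^-1 (- 4^-1) (is_derive_id _ _) (is_derive_sin_mul 2 t).
    move=> H; apply: is_derive_eq; rewrite mul1r.
    rewrite (_ : 2 * t = t + t) ?cosD; last by ring.
    by have := cos2Dsin2 t => H1; lra.
  by rewrite (FTC _ D) sinN !mulr0 sin0 !mulr0 !addr0 subr0 mul1r mulrC.
have D (t : R) : is_derive t 1 (fun t => (n.+1%:R * 2)^-1 * sin (n.+1%:R * t) +
    (- (n.+3%:R * 2)^-1) * sin (n.+3%:R * t)) (sin (n.+2%:R * t) * sin t).
  have := is_derive_lin2 (n.+1%:R * 2)^-1 (- (n.+3%:R * 2)^-1)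
    (is_derive_sin_mul n.+1%:R t) (is_derive_sin_mul n.+3%:R t).
  move=> H; apply: is_derive_eq.
  rewrite mulNr !mulrA !invfM [_ / 2 * _]mulrAC [n.+3%:R^-1 / 2 * _]mulrAC.
  rewrite !mulVf ?pnatr_eq0// !mul1r.
  have -> : n.+3%:R * t = n.+2%:R * t + t by rewrite -[n.+3]addn1 natrD mulrDl mul1r.
  have -> : n.+1%:R * t = n.+2%:R * t - t by rewrite -[n.+2]addn1 natrD; ring.
  by rewrite cosB cosD; field.
by rewrite (FTC _ D) !sinN !mulr0 !sin0 !mulr0 !addr0 subr0 !mul0r.
Qed.

End trigonometric_integrals.

(** * The semicircle law and its density *)

Section semicircle_moments.
Variable R : realType.
Local Notation mu := (@lebesgue_measure R).
Implicit Type r : R.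

Lemma semicircle_pdf_out r x : x \notin `[- (2 * `|r|), 2 * `|r|] -> semicircle_pdf r x = 0.
Proof.
move=> xr; rewrite /semicircle_pdf ler0_sqrtr ?mulr0// subr_le0.
rewrite -[x ^+ 2]real_normK ?num_real// -[r ^+ 2]real_normK ?num_real//.
rewrite (_ : 4 * _ = (2 * `|r|) ^+ 2); last by ring.
rewrite lerXn2r ?nnegrE// ?mulr_ge0//.
by move: xr; rewrite in_itv/= -ler_norml -ltNge => /ltW.
Qed.

Lemma integrable_semicircle_pdf r : mu.-integrable setT (EFin \o semicircle_pdf r).
Proof.
have mpdf := @measurable_semicircle_pdf R r.
have : mu.-integrable `[- (2 * `|r|), 2 * `|r|] (EFin \o semicircle_pdf r).
  apply: continuous_compact_integrable; first exact: segment_compact.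
  exact/continuous_subspaceT/continuous_semicircle_pdf.
have mI : measurable ([set` `[- (2 * `|r|), 2 * `|r|]] : set (measurableTypeR R)).
  exact: measurable_itv.
move=> H; have {H} := iffLR (integrable_mkcond _ mI) H.
apply: eq_integrable => //.
move=> x _; rewrite patchE; case: ifPn => // xr /=.
by rewrite semicircle_pdf_out//; move: xr; rewrite notin_setE => /negP.
Qed.

Fact semicircle_fin r : fin_num_fun (semicircle r).
Proof.
move=> V mV; rewrite /semicircle.
apply: (integrable_fin_num mV).
by apply: (integrableS measurableT) => //; exact: integrable_semicircle_pdf.
Qed.

HB.instance Definition _ r :=
  Measure_isFinite.Build _ _ _ (semicircle r) (semicircle_fin r).

Lemma semicircle_supp r : semicircle r (~` [set` `[- (2 * `|r|), 2 * `|r|]]) = 0%E.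
Proof.
rewrite /semicircle (eq_integral (cst 0%E)) ?integral0// => x.
by rewrite inE/= => /negP xr; rewrite semicircle_pdf_out.
Qed.

Lemma semicircle_dom r : semicircle r `<< mu.
Proof.
apply/null_content_dominatesP => A mA muA0.
rewrite /semicircle; apply: null_set_integral => //.
by apply/measurable_EFinP/measurable_funTS; exact: measurable_semicircle_pdf.
Qed.

(** The density is recovered as the Radon-Nikodym derivative of [semicircle r]: both have the same
    integrals over measurable sets, hence agree almost everywhere. *)
Lemma integral_semicircle r (f : R -> R) : continuous f ->
  (\int[semicircle r]_x (f x)%:E)%E = (\int[mu]_x (f x * semicircle_pdf r x)%:E)%E.
Proof.
move=> cf; have mf : measurable_fun [set: measurableTypeR R] (EFin \o f).
  by apply/measurable_EFinP; exact: continuous_measurable_fun.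
have mpdf : measurable_fun [set: measurableTypeR R] (EFin \o semicircle_pdf r).
  by apply/measurable_EFinP; exact: measurable_semicircle_pdf.
rewrite -(Radon_Nikodym_change_of_variables (semicircle_dom r))//=; last first.
  exact: (supported_integrable (semicircle_supp r)).
apply: ae_eq_integral => //.
- apply: emeasurable_funM => //; apply: (measurable_int mu).
  by apply: Radon_Nikodym_integrable; exact: semicircle_dom.
- exact: (@emeasurable_funM _ _ _ setT _ _ mf mpdf).
rewrite (_ : (fun x => (f x * semicircle_pdf r x)%:E) = ((EFin \o f) \* (EFin \o semicircle_pdf r))%E)//.
apply: ae_eqe_mul2l => /=.
rewrite Radon_NikodymE//=; first exact: semicircle_dom.
move=> smu; case: cid => /= h [h1 h2 h3].
apply: integral_ae_eq => //=.
by move=> E E01 mE; rewrite -h3.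
Qed.

End semicircle_moments.

Section semicircle_chebyshev.
Variable R : realType.
Local Notation mu := (@lebesgue_measure R).

Lemma continuous_horner (p : {poly R}) : continuous (horner p).
Proof.
elim/poly_ind: p => [|p c IH] x.
  rewrite (_ : horner 0 = cst 0); first exact: cvg_cst.
  by apply/funext => y; rewrite horner0.
rewrite (_ : horner _ = (fun y => p.[y] * y + c)); last first.
  by apply/funext => y; rewrite hornerMXaddC.
apply: cvgD; last exact: cvg_cst.
by apply: cvgM; [exact: IH|exact: cvg_id].
Qed.

Lemma continuous_horner_scale (p : {poly R}) (a : R) : continuous (fun x : R => p.[x / a]).
Proof.
move=> x; apply: (continuous_comp (f := fun x : R => x / a)).
  by apply: cvgM; [exact: cvg_id|exact: cvg_cst].
exact: continuous_horner.
Qed.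

(** Under [x = 2 r cos t] the root in the density becomes [2 r sin t], and [sin_cheb] reduces the
    integrand to [(2 / pi) sin((n + 1) t) sin t]. *)
Lemma integral_cheb_semicircle (r : R) n : 0 < r ->
  (\int[semicircle r]_x ((cheb R n).[x / r])%:E)%E = ((n == 0%N)%:R)%:E.
Proof.
move=> r0; have cf := @continuous_horner_scale (cheb R n) r.
rewrite (integral_semicircle _ cf).
pose G x := (cheb R n).[x / r] * semicircle_pdf r x.
have cG : continuous G.
  by move=> x; apply: cvgM; [exact: cf|exact: continuous_semicircle_pdf].
pose F (t : R) := 2 * r * cos t.
have F0 : F 0 = 2 * r by rewrite /F cos0 mulr1.
have Fpi : F pi = - (2 * r) by rewrite /F cospi mulrN1.
have -> : (\int[mu]_x (G x)%:E = \int[mu]_(x in `[F pi, F 0%R]) (G x)%:E)%E.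
  rewrite [RHS]integral_mkcond; apply: eq_integral => x _.
  rewrite patchE; case: ifPn => // xr; rewrite /G semicircle_pdf_out ?mulr0//.
  by move: xr; rewrite notin_setE F0 Fpi gtr0_norm// => /negP.
have dF (t : R) : is_derive t 1 F (- (2 * r * sin t)).
  by have := @is_deriveZ R R R cos (2 * r) t 1 _ (is_derive_cos t); rewrite /GRing.scale/= mulrN.
have F'E : (derive1 F) = (fun t => - (2 * r * sin t)).
  by apply/funext => t; rewrite derive1E derive_val.
have cF' : continuous (derive1 F).
  rewrite F'E => t; apply: cvgN; apply: cvgM; first exact: cvg_cst.
  exact: continuous_sin.
have cF : continuous F.
  by move=> t; apply: cvgM; [exact: cvg_cst|exact: continuous_cos].
have [c0 c1] : 0 <= (pi : R) /\ 0 < 2 * r by rewrite pi_ge0 mulr_gt0.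
have decF : {in `[0, pi] &, {homo F : x y /~ x < y}}.
  by move=> x y x0 y0 xy; rewrite /F ltr_pM2l// ltr_cos.
have cF'' : {in `]0, pi[, continuous (derive1 F)} by move=> t _; exact: cF'.
have F'0 : cvg (derive1 F x @[x --> 0^'+]).
  by apply/cvg_ex; exists (derive1 F 0); exact/cvg_at_right_filter/cF'.
have F'pi : cvg (derive1 F x @[x --> pi^'-]).
  by apply/cvg_ex; exists (derive1 F pi); exact/cvg_at_left_filter/cF'.
have LRF : derivable_oo_LRcontinuous F 0 pi.
  split => [t _||]; [exact: ex_derive|exact/cvg_at_right_filter/cF|].
  exact/cvg_at_left_filter/cF.
rewrite (integration_by_substitution_decreasing c0 decF cF'' F'0 F'pi LRF); last first.
  exact: continuous_subspaceT.
have -> : (\int[mu]_(t in `[0%R, pi]) (((G \o F) * - (derive1 F)) t)%:E =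
    \int[mu]_(t in `[0%R, pi]) ((2 / pi)%:E * (sin (n.+1%:R * t) * sin t)%:E))%E.
  apply: eq_integral => t; rewrite inE/= in_itv/= => tpi.
  have st : 0 <= sin t by exact: sin_ge0_pi.
  rewrite -EFinM; congr (_%:E).
  rewrite [LHS](_ : _ = G (F t) * - ((derive1 F) t))// F'E opprK /G /semicircle_pdf.
  have -> : F t / r = 2 * cos t by rewrite /F; field; rewrite gt_eqF.
  have -> : 4 * r ^+ 2 - F t ^+ 2 = (2 * r * sin t) ^+ 2.
    have := cos2Dsin2 t => cs; rewrite /F !exprMn.
    have -> : sin t ^+ 2 = 1 - cos t ^+ 2 by rewrite -cs; ring.
    by ring.
  rewrite sqrtr_sqr ger0_norm ?mulr_ge0// ?ltW//.
  have p0 : (pi : R) != 0 by rewrite gt_eqF ?pi_gt0.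
  rewrite -sin_cheb; move: (pi : R) p0 => q q0; field.
  by rewrite q0 gt_eqF.
rewrite integralZl//; last first.
  apply: continuous_compact_integrable; first exact: segment_compact.
  apply: continuous_subspaceT => t.
  by apply: cvgM; [exact: continuous_sin_mul|exact: continuous_sin].
rewrite integral_sin_mul_sin -EFinM; congr (_%:E).
have p0 : (pi : R) != 0 by rewrite gt_eqF ?pi_gt0.
by move: (pi : R) p0 => q q0; field.
Qed.

End semicircle_chebyshev.

Section semicircle_distribution.
Local Open Scope complex_scope.
Variable R : realType.
Variable m : nat -> R[i].
Hypothesis m0 : m 0%N = 1.

(** Both sides, as functionals of a polynomial in the variable rescaled by [1 / r], are additive and
    agree on Chebyshev polynomials. *)
Lemma semicircle_moment (r : R) k : 0 < r ->
  fock_ev m ((r%:C *: semicircular m) ^+ k) = (\int[semicircle r]_x (x ^+ k))%:C.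
Proof.
move=> r0.
pose f (p : {poly R}) := fock_ev m (horner_alg (semicircular m) (map_poly (real_complex R) p)).
pose g (p : {poly R}) : R[i] := (\int[semicircle r]_x p.[x / r])%:C.
have int (p : {poly R}) : (semicircle r).-integrable setT (EFin \o (fun x => p.[x / r])).
  by apply: (supported_integrable (semicircle_supp r)); exact: continuous_horner_scale.
have fD : {morph f : p q / p + q}.
  by move=> p q; rewrite /f rmorphD/= horner_algD.
have gD : {morph g : p q / p + q}.
  move=> p q; rewrite /g -rmorphD/= -RintegralD//.
  by congr (_%:C); apply: eq_Rintegral => x _; rewrite hornerD.
have := cheb_span fD gD _ k => /(_ _)/wrap[n|].
  rewrite /f /g map_cheb fock_ev_cheb// /Rintegral integral_cheb_semicircle//=.
  by rewrite rmorph_nat.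
rewrite /f /g map_polyXn rmorphXn/= horner_algX => fg.
rewrite exprZn linearZ/= fg -rmorphXn/= -rmorphM/=; congr (_%:C).
rewrite -RintegralZl//.
by apply: eq_Rintegral => x _; rewrite hornerXn -exprMn mulrC divfK// gt_eqF.
Qed.

End semicircle_distribution.

(** * Limits of empirical measures with convergent moments *)

Section measure_of_cdf.
Variable R : realType.

Lemma probability_of_cdf (F : R -> R) :
  {homo F : x y / x <= y} -> right_continuous F ->
  F x @[x --> -oo] --> (0 : R) -> F x @[x --> +oo] --> (1 : R) ->
  exists nu : probability (measurableTypeR R) R,
    forall x, nu [set` `]-oo, x]] = (F x)%:E.
Proof.
move=> ndF rcF F0 F1.
pose F' : cumulativeBounded 0 1 := HB.pack F (isCumulative.Build R _ R F ndF rcF)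
  (isCumulativeBounded.Build R 0 1 F F0 F1).
exists (lebesgue_stieltjes_measure F') => x.
by rewrite -(cdf_lebesgue_stieltjes_id F' x).
Qed.

(* The iteration [p_(n+1) = p_n + (x ^ 2 - p_n ^ 2) / 2] increases to [`|x|]. *)
Lemma norm_poly_approx (L e : R) : 0 < L -> 0 < e ->
  exists p : {poly R}, forall x, `|x| <= L -> `| `|x| - p.[x]| <= e.
Proof.
move=> L0 e0.
suff [p hp] : exists p : {poly R}, forall x, `|x| <= 1 -> `| `|x| - p.[x]| <= e / L.
  exists (L *: (p \Po (L^-1 *: 'X))) => x xL.
  rewrite hornerZ horner_comp hornerZ hornerX.
  have := hp (L^-1 * x); rewrite normrM gtr0_norm ?invr_gt0// mulrC ler_pdivrMr// mul1r.
  move=> /(_ xL); rewrite -[X in _ <= X -> _]mulrC -(ler_pM2l L0) mulrA divff ?gt_eqF// mul1r.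
  by rewrite -[X in X * _](gtr0_norm L0) -normrM mulrBr mulrCA divff ?gt_eqF// mulr1.
pose fix p (n : nat) : {poly R} :=
  if n is n'.+1 then p n' + 2^-1 *: ('X^2 - p n' ^+ 2) else 0.
have pS n x : (p n.+1).[x] = (p n).[x] + (x ^+ 2 - (p n).[x] ^+ 2) / 2.
  by rewrite /= hornerD hornerZ hornerD hornerN hornerXn horner_exp mulrC.
have H n x : `|x| <= 1 -> 0 <= (p n).[x] /\ 0 <= `|x| - (p n).[x] <= 2 / n.+2%:R.
  move=> x1; elim: n => [|n [p0 /andP[d0 dn]]].
    by rewrite /= horner0 subr0 normr_ge0 divff// x1; split.
  rewrite pS -[x ^+ 2]real_normK ?num_real//.
  set a := `|x| in x1 d0 dn *; set q := (p n).[x] in p0 d0 dn *.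
  set b : R := 2 / n.+2%:R in dn.
  have b1 : b <= 1 by rewrite /b ler_pdivrMr// mul1r ler_nat.
  split; first by nra.
  have -> : a - (q + (a ^+ 2 - q ^+ 2) / 2) = (a - q) * (1 - (a + q) / 2) by field.
  apply/andP; split; first by rewrite mulr_ge0//; lra.
  (* As [a + q >= a - q], the new error is at most [u (1 - u / 2)] with [u = a - q]. This increases
     for [u <= 1], so [u] may be replaced by its bound [b]. *)
  apply: (@le_trans _ _ (b * (1 - b / 2))).
    by nra.
  rewrite /b ler_pdivlMr//.
  have n2 : n.+2%:R != 0 :> R by rewrite pnatr_eq0.
  have -> : n.+3%:R = n.+2%:R + 1 :> R by rewrite natr1.
  have : 0 < n.+2%:R :> R by rewrite ltr0n.
  move: (n.+2%:R) n2 => y y0 yp.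
  have -> : 2 / y * (1 - 2 / y / 2) * (y + 1) = 2 - 2 / y ^+ 2 by field.
  by rewrite lerBlDr lerDl divr_ge0// sqr_ge0.
pose n := Num.bound (2 / (e / L)).
have eL : 0 < e / L by rewrite divr_gt0.
exists (p n) => x x1; have [_ /andP[d0 dn]] := H n x x1.
rewrite ger0_norm// (le_trans dn)// ler_pdivrMr// -ler_pdivrMl// mulrC.
have := archi_boundP (_ : 0 <= 2 / (e / L)); rewrite -/n => /(_ (divr_ge0 (ler0n _ _) (ltW eL))).
by move=> /ltW /le_trans; apply; rewrite ler_nat 2?leqW.
Qed.

End measure_of_cdf.

(** * Ramp functions and piecewise linear interpolation *)

Section interpolation.
Variable R : realType.

(** [y] is not confined to the interval, because the last increment of [f] on the grid used later
    involves a node beyond the right end. *)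
Lemma uniformly_continuous_itv (f : R -> R) (a b e : R) : continuous f -> 0 < e ->
  exists2 d, 0 < d & forall x y, a <= x <= b -> `|x - y| <= d -> `|f x - f y| <= e.
Proof.
move=> cf e0.
have /compact_near_coveringP cK := @segment_compact R a b.
have H : \forall d \near 0^'+, `[a, b]%classic `<=`
    (fun x => forall y, `|x - y| <= d -> `|f x - f y| <= e).
  apply: cK => x _.
  have e2 : 0 < e / 2 by rewrite divr_gt0.
  have /cvgrPdist_le/(_ _ e2)/nbhs_ballP[h /= h0 hx] := cf x.
  exists (ball x (h / 2), [set d | 0 < d < h / 2]).
    split; first by apply: nbhsx_ballx; rewrite divr_gt0.
    near=> d; rewrite /=; apply/andP; split.
      by near: d; exact: nbhs_right_gt.
    by near: d; apply: nbhs_right_lt; rewrite divr_gt0.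
  move=> [x' d] [/= xx' /andP[d0 dh]] y x'y.
  have fx' : `|f x - f x'| <= e / 2.
    by apply: hx; apply: le_ball xx'; rewrite ler_pdivrMr// ler_peMr// ?ler1n// ltW.
  have fy : `|f x - f y| <= e / 2.
    apply: hx; rewrite /ball/= (splitr h) -(subrK x' x) -addrA.
    by rewrite (le_lt_trans (ler_normD _ _))// ltrD// (le_lt_trans x'y).
  rewrite (splitr e) -(subrK (f x) (f x')) -addrA (le_trans (ler_normD _ _))// lerD//.
  by rewrite distrC.
have : \forall d \near 0^'+, 0 < d /\
    (forall x, `[a, b]%classic x -> forall y, `|x - y| <= d -> `|f x - f y| <= e).
  near=> d; split; first by near: d; exact: nbhs_right_gt.
  by near: d; exact: H.
move=> /filter_ex[d [d0 hd]]; exists d => // x y xab; apply: hd.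
by rewrite /= in_itv.
Unshelve. all: by end_near. Qed.

(** A continuous majorant of the indicator of []-oo, x]], equal to 0 from [x + d] on. *)
Definition ramp (x d y : R) : R := Num.max 0 (Num.min 1 ((x + d - y) / d)).

Lemma ramp_ge0 x d y : 0 <= ramp x d y. Proof. by rewrite le_max lexx. Qed.
Lemma ramp_le1 x d y : ramp x d y <= 1.
Proof. by rewrite ge_max ler01 ge_min lexx. Qed.

Lemma ramp_eq1 x d y : 0 < d -> y <= x -> ramp x d y = 1.
Proof.
move=> d0 yx; rewrite /ramp min_l ?max_r// ler_pdivlMr// mul1r; lra.
Qed.

Lemma ramp_eq0 x d y : 0 < d -> x + d <= y -> ramp x d y = 0.
Proof.
move=> d0 yx; rewrite /ramp max_l// ge_min orbC ler_pdivrMr// mul0r subr_le0 yx//.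
Qed.

Lemma ramp_le x x' d y : 0 < d -> x <= x' -> ramp x d y <= ramp x' d y.
Proof.
move=> d0 xx'; rewrite /ramp; apply: le_max2 => //; apply: le_min2 => //.
by rewrite ler_pM2r ?invr_gt0//; lra.
Qed.

Lemma ramp_leS x d d' y : 0 < d -> 0 < d' -> ramp x d y <= ramp (x + d) d' y.
Proof.
move=> d0 d'0; have [yx|xy] := leP y (x + d); first by rewrite (ramp_eq1 d'0 yx) ramp_le1.
by rewrite (ramp_eq0 d0 (ltW xy)) ramp_ge0.
Qed.

Lemma ramp_shift x h d y : 0 < d -> 0 <= h -> ramp (x + h) d y <= ramp x d y + h / d.
Proof.
move=> d0 h0; have hd : 0 <= h / d by rewrite divr_ge0// ltW.
rewrite /ramp (_ : (x + h + d - y) / d = (x + d - y) / d + h / d); last by field; rewrite gt_eqF.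
move: (_ / d) (h / d) hd => u v v0.
rewrite ge_max; apply/andP; split; first by rewrite addr_ge0// le_max lexx.
rewrite -lerBlDr le_max; apply/orP; right.
by rewrite le_min !lerBlDr !ge_min lexx orbT andbT lerDl v0.
Qed.

(** Reduces polynomial approximation of ramps to that of the absolute value. *)
Lemma rampE x d y : 0 < d ->
  ramp x d y = (`|y - (x + d)| - `|y - x|) / (2 * d) + 2^-1.
Proof.
move=> d0; have [yx|xy] := leP y x.
  rewrite ramp_eq1// !ler0_norm; [|lra|lra]; field; rewrite gt_eqF//.
have [yx|xy'] := leP (x + d) y.
  rewrite ramp_eq0// !ger0_norm; [|lra|lra]; field; rewrite gt_eqF//.
rewrite /ramp min_r; last by rewrite ler_pdivrMr// mul1r; lra.
rewrite max_r; last by rewrite divr_ge0//; lra.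
by rewrite ler0_norm ?ger0_norm; [field; rewrite gt_eqF//|lra|lra].
Qed.

(** Differences of neighbouring ramps are hat functions centred at the nodes; they telescope to a
    partition of unity on [[- L, L]]. *)
Lemma ramp_interpolation (f : R -> R) (L : R) (N : nat) (e : R) :
  0 < L -> (0 < N)%N -> 
  let d := 2 * L / N%:R in let x j := - L + j%:R * d in
  (forall u v, - L <= u <= L -> `|u - v| <= d -> `|f u - f v| <= e) ->
  forall y, - L <= y <= L ->
  `|f y - \sum_(i < N.+1) f (x i) * (ramp (x i) d y - ramp (x i - d) d y)| <= e.
Proof.
move=> L0 N0 d x hf y yL.
have NR : 0 < N%:R :> R by rewrite ltr0n.
have d0 : 0 < d by rewrite /d divr_gt0// mulr_gt0.
pose w i := ramp (x i) d y - ramp (x i - d) d y.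
have w0 i : 0 <= w i by rewrite subr_ge0 ramp_le//; lra.
have sw : \sum_(i < N.+1) w i = 1.
  have xS i : x i.+1 - d = x i by rewrite /x -natr1; ring.
  pose psi j := ramp (x j - d) d y.
  have -> : \sum_(i < N.+1) w i = \sum_(0 <= i < N.+1) (psi i.+1 - psi i).
    by rewrite big_mkord; apply: eq_bigr => i _; rewrite /psi xS.
  rewrite telescope_sumr// /psi xS ramp_eq1//; last first.
    by rewrite /x /d mulrC divfK ?gt_eqF//; lra.
  by rewrite ramp_eq0 ?subr0// /x mul0r; lra.
have -> : f y - \sum_(i < N.+1) f (x i) * w i = \sum_(i < N.+1) (f y - f (x i)) * w i.
  under [RHS]eq_bigr do rewrite mulrBl.
  by rewrite sumrB -mulr_sumr sw mulr1.
rewrite (le_trans (ler_norm_sum _ _ _))//.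
rewrite -[leRHS]mulr1 -sw mulr_sumr; apply: ler_sum => i _.
rewrite normrM (ger0_norm (w0 i)).
have [yx|yx] := leP `|y - x i| d; first by rewrite ler_wpM2r// hf.
suff -> : w i = 0 by rewrite !mulr0.
rewrite /w; move: yx; rewrite ltNge ler_distl negb_and -!ltNge => /orP[yx|yx].
  by rewrite !ramp_eq1 ?subrr//; lra.
by rewrite !ramp_eq0 ?subrr//; lra.
Qed.

End interpolation.

(** * Averages over finite lists and functions of polynomial growth *)

Section averages.
Variable R : realType.
Implicit Types (s : seq R) (f g : R -> R).

Definition avg s f : R := (size s)%:R^-1 * \sum_(y <- s) f y.

Lemma avgD s f g : avg s (fun x => f x + g x) = avg s f + avg s g.
Proof. by rewrite /avg big_split/= mulrDr. Qed.

Lemma avgZ s a f : avg s (fun x => a * f x) = a * avg s f.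
Proof. by rewrite /avg -mulr_sumr mulrCA. Qed.

Lemma avgB s f g : avg s (fun x => f x - g x) = avg s f - avg s g.
Proof. by rewrite /avg sumrB mulrBr. Qed.

Lemma avg_sum s (I : Type) (r : seq I) (F : I -> R -> R) :
  avg s (fun x => \sum_(i <- r) F i x) = \sum_(i <- r) avg s (F i).
Proof. by rewrite /avg exchange_big/= mulr_sumr. Qed.

Lemma avg_cst s a : (0 < size s)%N -> avg s (fun=> a) = a.
Proof.
move=> s0; rewrite /avg big_const_seq count_predT iter_addr_0 -[a *+ _]mulr_natr mulrCA.
by rewrite mulVf ?mulr1// pnatr_eq0 -lt0n.
Qed.

Lemma le_avg s f g : (forall x, f x <= g x) -> avg s f <= avg s g.
Proof. by move=> fg; rewrite /avg ler_wpM2l ?invr_ge0// ler_sum. Qed.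

Lemma ler_norm_avg s f : `|avg s f| <= avg s (fun x => `|f x|).
Proof.
by rewrite /avg normrM ger0_norm ?invr_ge0// ler_wpM2l ?invr_ge0// ler_norm_sum.
Qed.

(** Points of the lists may lie outside [[- L, L]]; polynomial growth there is what moments can
    absorb. *)
Definition dominated_off (L : R) f :=
  exists B j, 0 <= B /\ forall x, L < `|x| -> `|f x| <= B * `|x| ^+ j.

Lemma dominated_offD L f g : 1 <= L -> dominated_off L f -> dominated_off L g ->
  dominated_off L (fun x => f x + g x).
Proof.
move=> L1 [B [j [B0 hB]]] [D [k [D0 hD]]]; exists (B + D), (maxn j k).
split => [|x Lx]; first exact: addr_ge0.
have x1 : 1 <= `|x| by rewrite (le_trans L1)// ltW.
rewrite mulrDl (le_trans (ler_normD _ _))// lerD//.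
  by rewrite (le_trans (hB _ Lx))// ler_wpM2l// ler_weXn2l// leq_maxl.
by rewrite (le_trans (hD _ Lx))// ler_wpM2l// ler_weXn2l// leq_maxr.
Qed.

Lemma dominated_off_poly L (p : {poly R}) : 1 <= L -> dominated_off L (horner p).
Proof.
move=> L1; exists (\sum_(i < size p) `|p`_i|), (size p).
split => [|x Lx]; first exact: sumr_ge0.
have x1 : 1 <= `|x| by rewrite (le_trans L1)// ltW.
rewrite horner_coef (le_trans (ler_norm_sum _ _ _))// mulr_suml ler_sum// => i _.
by rewrite normrM normrX ler_wpM2l// ler_weXn2l// ltnW.
Qed.

Lemma dominated_offZ L a f : dominated_off L f -> dominated_off L (fun x => a * f x).
Proof.
move=> [B [j [B0 hB]]]; exists (`|a| * B), j; split => [|x Lx]; first exact: mulr_ge0.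
by rewrite normrM -mulrA ler_wpM2l// hB.
Qed.

Lemma dominated_off_bounded L f M : (forall x, `|f x| <= M) -> dominated_off L f.
Proof.
move=> fM; exists M, 0%N; split; first exact: le_trans (fM 0).
by move=> x _; rewrite mulr1.
Qed.

End averages.

(** * From convergent moments to a limit law *)

Section moment_limit.
Variables (R : realType) (ys : nat -> seq R) (c : nat -> R) (K : R).
Hypotheses (ys0 : forall n, (0 < size (ys n))%N) (K0 : 0 <= K).
Hypothesis cK : forall k, `|c k| <= K ^+ k.
Hypothesis mom : forall k, avg (ys n) (fun y => y ^+ k) @[n --> \oo] --> c k.
(** A margin beyond [K], so that the powers of [K / L] tend to 0. *)
Let L := K + 1.
Let L1 : 1 <= L. Proof. by rewrite /L lerDr. Qed.
Let L0 : 0 < L. Proof. exact: lt_le_trans L1. Qed.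

(** Off [[- L, L]], growth of degree [j] is dominated by a multiple of [x ^+ i.*2], whose average
    has limit at most [B L^j (K / L)^(2 i)]. This is below [e' - e] for large [i]. *)
Lemma avg_tail h e e' : dominated_off L h -> 0 <= e ->
  (forall x, `|x| <= L -> `|h x| <= e) -> e < e' ->
  \forall n \near \oo, `|avg (ys n) h| <= e'.
Proof.
move=> [B [j [B0 hB]]] e0 he ee'.
have L0' := ltW L0; have q1 : `|K / L| < 1.
  by rewrite ger0_norm ?divr_ge0 // ltr_pdivrMr// mul1r /L ltrDl.
have [i [ij iq]] : exists i, (j <= i.*2)%N /\ B * L ^+ j * (K / L) ^+ i.*2 < e' - e.
  have : B * L ^+ j * (K / L) ^+ n @[n --> \oo] --> B * L ^+ j * 0.
    apply: cvgM; [exact: cvg_cst|exact: cvg_expr].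
  rewrite mulr0 => /cvgrPdist_lt/(_ (e' - e)); rewrite subr_gt0 => /(_ ee')[N _ hN].
  exists (N + j)%N; split; first by rewrite doubleD -!addnn; lia.
  have := hN (N + j).*2; rewrite /= sub0r normrN => /(_ _)/(le_lt_trans (ler_norm _)); apply.
  by rewrite -addnn; lia.
pose D := B * L ^+ j / L ^+ i.*2.
have D0 : 0 <= D by rewrite /D divr_ge0 ?mulr_ge0 ?exprn_ge0.
have hD x : `|h x| <= e + D * x ^+ i.*2.
  have xx : 0 <= x ^+ i.*2 by rewrite -mul2n exprM exprn_ge0// sqr_ge0.
  have [xL|Lx] := leP `|x| L; first by rewrite (le_trans (he _ xL))// lerDl mulr_ge0.
  rewrite (le_trans (hB _ Lx))// -[leLHS]add0r lerD//.
  rewrite -[x ^+ _]ger0_norm// normrX /D -!mulrA ler_wpM2l//.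
  have -> : L ^+ j * (L ^- i.*2 * `|x| ^+ i.*2) = (`|x| / L) ^+ (i.*2 - j) * `|x| ^+ j.
    rewrite -{1 2}(subnK ij) !exprD expr_div_n; field.
    by rewrite !expf_neq0// gt_eqF.
  rewrite ler_peMl ?exprn_ge0// exprn_ege1// ler_pdivlMr// mul1r ltW//.
have c2 : c i.*2 <= K ^+ i.*2 by rewrite (le_trans (ler_norm _)).
have lim : e + D * avg (ys n) (fun y => y ^+ i.*2) @[n --> \oo] --> e + D * c i.*2.
  by apply: cvgD; [exact: cvg_cst|apply: cvgM; [exact: cvg_cst|exact: mom]].
have lt : e + D * c i.*2 < e'.
  rewrite -ltrBrDl (le_lt_trans _ iq)// (le_trans (ler_wpM2l D0 c2))//.
  by rewrite /D expr_div_n mulrAC -!mulrA.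
apply: filterS (cvgr_le _ lim _ lt) => n; apply: le_trans.
rewrite (le_trans (ler_norm_avg _ _))// (le_trans (le_avg _ hD))//.
by rewrite avgD avg_cst// avgZ.
Qed.

Lemma avg_poly_cvg (p : {poly R}) :
  avg (ys n) (horner p) @[n --> \oo] --> \sum_(i < size p) p`_i * c i.
Proof.
have E n : avg (ys n) (horner p) = \sum_(i < size p) p`_i * avg (ys n) (fun y => y ^+ i).
  rewrite (_ : horner p = fun x => \sum_(i < size p) p`_i * x ^+ i); last first.
    by apply/funext => x; rewrite horner_coef.
  by rewrite avg_sum; apply: eq_bigr => i _; rewrite avgZ.
under eq_fun do rewrite E.
by apply: cvg_big_sum => i; apply: cvgM; [exact: cvg_cst|exact: mom].
Qed.

(** No candidate for the limit is at hand. The Cauchy criterion is met by balls centred at the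
    limits for approximating polynomials. *)
Lemma avg_is_cvg f : dominated_off L f ->
  (forall e, 0 < e -> exists p : {poly R}, forall x, `|x| <= L -> `|f x - p.[x]| <= e) ->
  cvgn (fun n => avg (ys n) f).
Proof.
move=> Lf fp; apply/cauchy_cvgP/cauchy_exP => e e0.
have [p hp] := fp (e / 4) (divr_gt0 e0 (ltr0n _ 4)).
exists (\sum_(i < size p) p`_i * c i).
have dp : dominated_off L (fun x => f x - p.[x]).
  apply: dominated_offD => //.
  rewrite (_ : (fun _ => _) = (fun x => -1 * p.[x])); last first.
    by apply/funext => x; rewrite mulN1r.
  by apply: dominated_offZ; exact: dominated_off_poly.
have e4 : e / 4 < e / 2 by lra.
have e40 : 0 <= e / 4 by lra.
have e20 : 0 < e / 2 by lra.
have T := avg_tail dp e40 hp e4.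
have P : \forall n \near \oo, `|\sum_(i < size p) p`_i * c i - avg (ys n) (horner p)| < e / 2.
  by move/cvgrPdist_lt : (@avg_poly_cvg p); apply.
suff : \forall n \near \oo, `|\sum_(i < size p) p`_i * c i - avg (ys n) f| < e by [].
near=> n.
have -> : \sum_(i < size p) p`_i * c i - avg (ys n) f =
  (\sum_(i < size p) p`_i * c i - avg (ys n) (horner p)) -
    avg (ys n) (fun x => f x - p.[x]) by rewrite avgB; ring.
rewrite (le_lt_trans (ler_normB _ _))// (splitr e) ltr_leD//.
  by near: n.
by near: n.
Unshelve. all: by end_near. Qed.

Lemma avg_norm_cvg a : cvgn (fun n => avg (ys n) (fun x => `|x - a|)).
Proof.
apply: avg_is_cvg.
  exists (1 + `|a|), 1%N; split => [|x Lx]; first by rewrite addr_ge0.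
  have x1 : 1 <= `|x| by rewrite (le_trans L1)// ltW.
  by rewrite normr_id expr1 mulrDl mul1r (le_trans (ler_normB _ _))// lerD// ler_peMr.
move=> e e0; have La : 0 < L + `|a| by rewrite ltr_wpDr.
have [p hp] := norm_poly_approx La e0.
exists (p \Po ('X - a%:P)) => x xL; rewrite horner_comp hornerXsubC.
by apply: hp; rewrite (le_trans (ler_normB _ _))// lerD.
Qed.

Lemma avg_ramp_cvg x d : 0 < d -> cvgn (fun n => avg (ys n) (ramp x d)).
Proof.
move=> d0; have E n : avg (ys n) (ramp x d) =
    (2 * d)^-1 * (avg (ys n) (fun y => `|y - (x + d)|) - avg (ys n) (fun y => `|y - x|)) + 2^-1.
  rewrite -avgB -avgZ -[X in _ + X](avg_cst 2^-1 (ys0 n)) -avgD; congr avg.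
  by apply/funext => y; rewrite rampE// mulrC.
under eq_fun do rewrite E.
apply: is_cvgD; last exact: is_cvg_cst.
apply: is_cvgMr; apply: is_cvgB; exact: avg_norm_cvg.
Qed.

Lemma avg_cvg0 h : dominated_off L h -> (forall x, `|x| <= L -> h x = 0) ->
  avg (ys n) h @[n --> \oo] --> (0 : R).
Proof.
move=> Lh h0; apply/cvgrPdist_le => e e0.
have he x : `|x| <= L -> `|h x| <= 0 by move/h0->; rewrite normr0.
by apply: filterS (avg_tail Lh (lexx 0) he e0) => n; rewrite sub0r normrN.
Qed.

Definition ramp_lim x d : R := limn (fun n => avg (ys n) (ramp x d)).

Lemma dominated_off_ramp x d : dominated_off L (ramp x d).
Proof.
by apply: (@dominated_off_bounded _ _ _ 1) => y; rewrite ger0_norm ?ramp_ge0// ramp_le1.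
Qed.

Lemma le_ramp_lim x d x' d' a : 0 < d -> 0 < d' ->
  (forall y, ramp x d y <= ramp x' d' y + a) -> ramp_lim x d <= ramp_lim x' d' + a.
Proof.
move=> d0 d'0 le; have c1 := @avg_ramp_cvg x d d0; have c2 := @avg_ramp_cvg x' d' d'0.
have h2 : avg (ys n) (ramp x' d') + a @[n --> \oo] --> ramp_lim x' d' + a.
  by apply: cvgD; [exact: c2|exact: cvg_cst].
apply: (ler_cvg_to c1 h2); apply: nearW => n.
by rewrite -[X in _ + X](avg_cst a (ys0 n)) -avgD; exact: le_avg.
Qed.

Lemma ramp_lim_ge0 x d : 0 < d -> 0 <= ramp_lim x d.
Proof.
move=> d0; apply: limr_ge; first exact: avg_ramp_cvg.
apply: nearW => n; rewrite -[leLHS](avg_cst 0 (ys0 n)).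
by apply: le_avg => y; exact: ramp_ge0.
Qed.

Lemma ramp_lim_eq0 x d : 0 < d -> x + d <= - L -> ramp_lim x d = 0.
Proof.
move=> d0 xd; apply/cvg_lim => //; apply: avg_cvg0; first exact: dominated_off_ramp.
by move=> y; rewrite ler_norml => /andP[Ly _]; rewrite ramp_eq0// (le_trans xd).
Qed.

Lemma ramp_lim_eq1 x d : 0 < d -> L <= x -> ramp_lim x d = 1.
Proof.
move=> d0 Lx; apply/cvg_lim => //; rewrite -[X in _ --> X]addr0.
rewrite (_ : (fun n => _) = (fun n => 1 + avg (ys n) (fun y => ramp x d y - 1))); last first.
  by apply/funext => n; rewrite avgB avg_cst// addrC subrK.
apply: cvgD; first exact: cvg_cst.
apply: avg_cvg0.
  by apply: (dominated_offD L1 (dominated_off_ramp _ _)); apply: (@dominated_off_bounded _ _ _ `|-1|).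
by move=> y; rewrite ler_norml => /andP[_ yL]; rewrite ramp_eq1 ?subrr// (le_trans yL).
Qed.

(** As [d] tends to 0 the ramps decrease to the indicator of []-oo, x]], hence the infimum. *)
Definition limit_cdf x : R := inf [set ramp_lim x d | d in [set d | 0 < d]].

Lemma limit_cdf_le x d : 0 < d -> limit_cdf x <= ramp_lim x d.
Proof.
move=> d0; apply: ge_inf; last by exists d.
by exists 0 => _ [d' d'0 <-]; exact: ramp_lim_ge0.
Qed.

Lemma le_limit_cdf x a : (forall d, 0 < d -> a <= ramp_lim x d) -> a <= limit_cdf x.
Proof.
move=> ha; apply: lb_le_inf; first by exists (ramp_lim x 1), 1 => //=.
by move=> _ [d d0 <-]; exact: ha.
Qed.

Lemma ramp_lim_le x d : 0 < d -> ramp_lim x d <= limit_cdf (x + d).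
Proof.
move=> d0; apply: le_limit_cdf => d' d'0; rewrite -[leRHS]addr0.
by apply: le_ramp_lim => // y; rewrite addr0 ramp_leS.
Qed.

Lemma limit_cdf_nd : {homo limit_cdf : x y / x <= y}.
Proof.
move=> x y xy; apply: le_limit_cdf => d d0.
rewrite (le_trans (limit_cdf_le x d0))// -[leRHS]addr0.
by apply: le_ramp_lim => // z; rewrite addr0 ramp_le.
Qed.

(** For fixed [d], [ramp_lim] grows in [x] at rate at most [1 / d], so the infimum cannot jump up
    immediately to the right of [x]. *)
Lemma limit_cdf_rc : right_continuous limit_cdf.
Proof.
move=> x; apply/cvgrPdist_le => e e0.
have e20 : 0 < e / 2 by rewrite divr_gt0.
have [_ [d /= d0 <-] hd] : exists2 z, [set ramp_lim x d | d in [set d | 0 < d]] z &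
    z < limit_cdf x + e / 2.
  apply: inf_adherent => //; split; first by exists (ramp_lim x 1), 1 => /=.
  by exists 0 => _ [d' d'0 <-]; exact: ramp_lim_ge0.
near=> y; have xy : x <= y by near: y; exact: nbhs_right_ge.
rewrite distrC ger0_norm ?subr_ge0 ?limit_cdf_nd//.
have yd : (y - x) / d <= e / 2.
  rewrite ler_pdivrMr// lerBlDl; near: y; apply: nbhs_right_le.
  by rewrite ltrDl mulr_gt0.
rewrite lerBlDl (le_trans (limit_cdf_le y d0))//.
have : ramp_lim y d <= ramp_lim x d + (y - x) / d.
  apply: le_ramp_lim => // z.
  by rewrite -{1}(subrK x y) [y - x + x]addrC ramp_shift// subr_ge0.
by move=> /le_trans; apply; lra.
Unshelve. all: by end_near. Qed.

Lemma limit_cdf_eq0 x : x < - L -> limit_cdf x = 0.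
Proof.
move=> xL; apply/eqP; rewrite eq_le; apply/andP; split; last first.
  by apply: le_limit_cdf => d d0; exact: ramp_lim_ge0.
have d0 : 0 < - L - x by rewrite subr_gt0.
by rewrite (le_trans (limit_cdf_le x d0))// ramp_lim_eq0//; lra.
Qed.

Lemma limit_cdf_eq1 x : L <= x -> limit_cdf x = 1.
Proof.
move=> xL; apply/eqP; rewrite eq_le; apply/andP; split.
  by rewrite (le_trans (limit_cdf_le x ltr01))// ramp_lim_eq1.
by apply: le_limit_cdf => d d0; rewrite ramp_lim_eq1.
Qed.

Lemma limit_probability : exists nu : probability (measurableTypeR R) R,
  forall x, nu [set` `]-oo, x]] = (limit_cdf x)%:E.
Proof.
apply: probability_of_cdf; [exact: limit_cdf_nd|exact: limit_cdf_rc| |].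
  apply: cvg_near_cst; near=> x; apply: limit_cdf_eq0.
  by near: x; apply: nbhs_ninfty_lt; exact: num_real.
apply: cvg_near_cst; near=> x; apply: limit_cdf_eq1.
by near: x; apply: nbhs_pinfty_ge; exact: num_real.
Unshelve. all: by end_near. Qed.

Section limit_measure.
Variable nu : probability (measurableTypeR R) R.
Hypothesis nuF : forall x, nu [set` `]-oo, x]] = (limit_cdf x)%:E.
(** [limit_cdf] is shown to vanish only strictly below [- L]; the margin places both ends of the
    interval where its values are known. *)
Let L' := L + 1.

Lemma limit_support : nu (~` [set` `[- L', L']]) = 0%E.
Proof.
have mN x : measurable ([set` `]-oo, x]] : set (measurableTypeR R)) by exact: measurable_itv.
have sub : ~` [set` `[- L', L']] `<=` [set` `]-oo, - L']] `|` ~` [set` `]-oo, L']].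
  move=> x /=; rewrite !in_itv/=; have [//|xL] := leP x (- L'); first by left.
  by move=> H; right => xL'; apply: H; rewrite (ltW xL).
apply/eqP; rewrite eq_le measure_ge0 andbT.
apply: (le_trans (le_measure nu _ _ sub)).
- by rewrite inE; apply: measurableC; exact: measurable_itv.
- by rewrite inE; apply: measurableU => //; exact: measurableC.
have -> : 0%E = (nu [set` `]-oo, (- L')%R]] + nu (~` [set` `]-oo, L']]))%E.
  rewrite probability_setC// !nuF limit_cdf_eq0 ?limit_cdf_eq1 /L'; [|lra|lra].
  by rewrite subee ?adde0.
exact: (measureU2 nu (mN _) (measurableC (mN _))).
Qed.

Lemma continuous_ramp (x d : R) : continuous (ramp x d).
Proof.
have cl : continuous (fun y : R => (x + d - y) / d).
  move=> y; apply: cvgM; last exact: cvg_cst.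
  by apply: cvgB; [exact: cvg_cst|exact: cvg_id].
move=> y; apply: (@continuous_max _ _ (cst 0) (fun y => Num.min 1 ((x + d - y) / d))).
  exact: cvg_cst.
apply: (@continuous_min _ _ (cst 1) (fun y => (x + d - y) / d)); first exact: cvg_cst.
exact: cl.
Qed.

(** By [limit_cdf_le] and [ramp_lim_le], [ramp_lim x d] obeys the same two bounds, so it differs
    from the integral by at most the mass between [x] and [x + d]. *)
Lemma integral_ramp_bounds x d : 0 < d ->
  limit_cdf x <= (\int[nu]_y ramp x d y)%R <= limit_cdf (x + d).
Proof.
move=> d0; have mN z : measurable ([set` `]-oo, z]] : set (measurableTypeR R)).
  exact: measurable_itv.
have mr : measurable_fun [set: measurableTypeR R] (EFin \o ramp x d).
  by apply/measurable_EFinP; apply: continuous_measurable_fun; exact: continuous_ramp.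
have mi z : measurable_fun [set: measurableTypeR R] (EFin \o \1_(`]-oo, z]%classic : set R)).
  by apply/measurable_EFinP; exact: measurable_indic.
have Fi z : (limit_cdf z)%:E = (\int[nu]_y (\1_(`]-oo, z]%classic : set R) y)%:E)%E.
  rewrite integral_indic// setIT; exact: (esym (nuF z)).
rewrite -!lee_fin /Rintegral fineK; last first.
  by apply: (integrable_fin_num measurableT); apply: (supported_integrable limit_support);
    exact: continuous_ramp.
rewrite !Fi; apply/andP; split; apply: ge0_le_integral => //.
- exact: mi.
- move=> y _; rewrite lee_fin indicE; case: (boolP (y \in _)) => /=.
    by rewrite inE/= in_itv/= => yx; rewrite ramp_eq1.
  by rewrite ramp_ge0.
- by move=> y _; rewrite lee_fin ramp_ge0.
- exact: mi.
- move=> y _; rewrite lee_fin indicE; case: (boolP (y \in _)) => /=.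
    by rewrite ramp_le1.
  by rewrite notin_setE/= in_itv/= => /negP; rewrite -ltNge => yx; rewrite ramp_eq0// ltW.
Qed.

Lemma abel_sum (f D : nat -> R) n :
  \sum_(i < n) f i * (D i.+1 - D i) =
  f n * D n - f 0%N * D 0%N - \sum_(i < n) (f i.+1 - f i) * D i.+1.
Proof.
elim: n => [|n IH]; first by rewrite !big_ord0; ring.
by rewrite !big_ord_recr/= IH; ring.
Qed.

Lemma continuous_sumr (F : nat -> R -> R) n : (forall i, continuous (F i)) ->
  continuous (fun y => \sum_(i < n) F i y).
Proof.
move=> cF; elim: n => [|n IH] y.
  rewrite (_ : (fun _ => _) = cst 0); first exact: cvg_cst.
  by apply/funext => z; rewrite big_ord0.
rewrite (_ : (fun _ => _) = (fun z => \sum_(i < n) F i z + F n z)); last first.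
  by apply/funext => z; rewrite big_ord_recr.
by apply: cvgD; [exact: IH|exact: cF].
Qed.

Lemma Rintegral_sum_cont (F : nat -> R -> R) n : (forall i, continuous (F i)) ->
  (\int[nu]_y (\sum_(i < n) F i y))%R = \sum_(i < n) (\int[nu]_y F i y)%R.
Proof.
move=> cF; elim: n => [|n IH].
  rewrite big_ord0 (@eq_Rintegral _ _ _ nu setT (cst 0)) ?Rintegral_cst ?mul0r//.
  by move=> y _; rewrite big_ord0.
rewrite big_ord_recr/= -IH -RintegralD//.
- by apply: eq_Rintegral => y _; rewrite big_ord_recr.
- by apply: (supported_integrable limit_support); exact: continuous_sumr.
- by apply: (supported_integrable limit_support).
Qed.

(** Limits and integrals of single ramps are compared only up to the mass of a mesh cell. Summation
    by parts moves these errors onto increments of [f], which are small, and the masses add up to at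
    most 1. *)
Lemma avg_cvg_limit (f : R -> R) : continuous f -> dominated_off L f ->
  avg (ys n) f @[n --> \oo] --> (\int[nu]_x f x)%R.
Proof.
move=> cf Lf; apply/cvgrPdist_le => e0 e0_gt0.
(* One [e] each for [int_fg], [Lg_int] and [A], and two for the tail estimate [T]. *)
pose e := e0 / 5; have e_gt0 : 0 < e by rewrite divr_gt0.
have LL' : L < L' by rewrite /L' ltrDl.
have L'0 : 0 < L' by exact: lt_trans LL'.
have [d1 d1_gt0 fd1] := uniformly_continuous_itv (- L') L' cf e_gt0.
pose N := (Num.bound (2 * L' / d1)).+1.
pose d := 2 * L' / N%:R.
have NR : 0 < N%:R :> R by rewrite ltr0n.
have d_gt0 : 0 < d by rewrite /d divr_gt0// mulr_gt0.
have dd1 : d <= d1.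
  rewrite /d ler_pdivrMr// [d1 * _]mulrC -ler_pdivrMr//.
  have b0 : 0 <= 2 * L' / d1 by rewrite divr_ge0// ltW// mulr_gt0.
  by rewrite (le_trans (ltW (archi_boundP b0)))// ler_nat.
pose x j := - L' + j%:R * d.
have xS j : x j.+1 = x j + d by rewrite /x -natr1; ring.
have xN : x N = L' by rewrite /x /d mulrC divfK ?gt_eqF//; ring.
have x_in j : (j <= N)%N -> - L' <= x j <= L'.
  move=> jN; apply/andP; split; first by rewrite /x lerDl mulr_ge0// ltW.
  by rewrite -xN /x lerD2l ler_pM2r// ler_nat.
have fd u v : - L' <= u <= L' -> `|u - v| <= d -> `|f u - f v| <= e.
  by move=> uL uv; apply: fd1 => //; exact: le_trans dd1.
pose g y := \sum_(i < N.+1) f (x i) * (ramp (x i) d y - ramp (x i - d) d y).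
have fg y : - L' <= y <= L' -> `|f y - g y| <= e.
  exact: (@ramp_interpolation R f L' N e L'0 (ltn0Sn _) fd).
pose G i y := f (x i) * (ramp (x i) d y - ramp (x i - d) d y).
have cG i : continuous (G i).
  move=> y; apply: cvgM; first exact: cvg_cst.
  by apply: cvgB; exact: continuous_ramp.
have cg : continuous g by exact: (@continuous_sumr G N.+1 cG).
pose Lg := \sum_(i < N.+1) f (x i) * (ramp_lim (x i) d - ramp_lim (x i - d) d).
have avg_g : avg (ys n) g @[n --> \oo] --> Lg.
  have E n : avg (ys n) g =
      \sum_(i < N.+1) f (x i) * (avg (ys n) (ramp (x i) d) - avg (ys n) (ramp (x i - d) d)).
    by rewrite /g avg_sum; apply: eq_bigr => i _; rewrite avgZ avgB.
  under eq_fun do rewrite E.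
  apply: cvg_big_sum => i; apply: cvgM; first exact: cvg_cst.
  by apply: cvgB; exact: avg_ramp_cvg.
pose I z := (\int[nu]_y ramp z d y)%R.
have int_g : (\int[nu]_y g y)%R = \sum_(i < N.+1) f (x i) * (I (x i) - I (x i - d)).
  rewrite (@Rintegral_sum_cont G N.+1 cG); apply: eq_bigr => i _.
  rewrite RintegralZl//; last first.
    apply: (supported_integrable limit_support) => y.
    by apply: cvgB; exact: continuous_ramp.
  by congr (_ * _); rewrite RintegralB//; apply: (supported_integrable limit_support);
    exact: continuous_ramp.
have int_fg : `|(\int[nu]_y f y)%R - (\int[nu]_y g y)%R| <= e.
  have if_ := supported_integrable limit_support cf.
  have ig := supported_integrable limit_support cg.
  have cfg : continuous (fun y => f y - g y) by move=> y; apply: cvgB; [exact: cf|exact: cg].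
  have ifg := supported_integrable limit_support cfg.
  rewrite -RintegralB// (supported_Rintegral limit_support cfg).
  have mI : measurable ([set` `[- L', L']] : set (measurableTypeR R)) by exact: measurable_itv.
  have ifgI := integrableS measurableT mI (@subsetT _ _) ifg.
  rewrite (le_trans (le_normr_Rintegral mI ifgI))//.
  have : (\int[nu]_(y in [set` `[- L', L']]) `|f y - g y| <= \int[nu]_(y in [set` `[- L', L']]) (cst e y))%R.
    apply: le_Rintegral => //.
    - exact: (integrable_norm ifgI).
    - apply: (integrableS measurableT) => //.
      by apply: (supported_integrable limit_support) => y; exact: cvg_cst.
  move=> /le_trans; apply; rewrite Rintegral_cst//; apply: ler_piMr; first exact: ltW.
  rewrite -lee_fin fineK ?fin_num_measure// probability_le1//.
have Lg_int : `|(\int[nu]_y g y)%R - Lg| <= e.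
  (* [D j] is bounded by the mass of []x j - d, x j]]. It vanishes at both ends of the grid, which
     removes the boundary terms of the summation by parts. *)
  pose D j := ramp_lim (x j - d) d - I (x j - d).
  have hD j : `|D j| <= limit_cdf (x j) - limit_cdf (x j - d).
    have /andP[I1 I2] := integral_ramp_bounds (x j - d) d_gt0.
    have R1 := limit_cdf_le (x j - d) d_gt0.
    have R2 := ramp_lim_le (x j - d) d_gt0.
    rewrite subrK in I2 R2; rewrite /D /I ler_norml; apply/andP; split; lra.
  have xSd j : x j.+1 - d = x j by rewrite xS addrK.
  have D0 : D 0%N = 0.
    apply/normr0_eq0/eqP; rewrite eq_le normr_ge0 andbT (le_trans (hD _))//.
    rewrite [limit_cdf (x 0%N)]limit_cdf_eq0 ?[limit_cdf (_ - d)]limit_cdf_eq0 ?subrr//; rewrite /x; lra.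
  have DN : D N.+1 = 0.
    apply/normr0_eq0/eqP; rewrite eq_le normr_ge0 andbT (le_trans (hD _))//.
    have xN0 : L <= x N by rewrite xN ltW.
    have xN1 : L <= x N.+1 by rewrite xS (le_trans xN0)// lerDl ltW.
    by rewrite xSd !limit_cdf_eq1// subrr.
  rewrite distrC int_g /Lg -sumrB.
  rewrite (eq_bigr (fun i : 'I_N.+1 => f (x i) * (D i.+1 - D i))); last first.
    by move=> i _; rewrite /D xSd; ring.
  rewrite (abel_sum (f \o x)) D0 DN !mulr0 subrr sub0r normrN.
  rewrite (le_trans (ler_norm_sum _ _ _))//.
  apply: (@le_trans _ _ (\sum_(i < N.+1) e * (limit_cdf (x i.+1) - limit_cdf (x i)))).
    apply: ler_sum => i _; rewrite normrM; apply: ler_pM => //.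
      rewrite distrC /=; apply: fd; first by apply: x_in; rewrite -ltnS.
      by rewrite xS opprD addrA subrr sub0r normrN gtr0_norm.
    by rewrite -[in leRHS](xSd i) hD.
  rewrite -mulr_sumr; apply: ler_piMr; first exact: ltW.
  rewrite -(big_mkord xpredT (fun i => limit_cdf (x i.+1) - limit_cdf (x i))).
  rewrite (telescope_sumr (fun i => limit_cdf (x i)))//.
  rewrite (@limit_cdf_eq1 (x N.+1)); last by rewrite xS xN; lra.
  by rewrite lerBlDr lerDl; apply: le_limit_cdf => d' d'0; exact: ramp_lim_ge0.
have dfg : dominated_off L (fun y => f y - g y).
  apply: dominated_offD => //.
  apply: (@dominated_off_bounded _ _ _ (\sum_(i < N.+1) `|f (x i)|)) => y.
  rewrite normrN (le_trans (ler_norm_sum _ _ _))//; apply: ler_sum => i _.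
  rewrite normrM ler_piMr// ler_norml.
  have := ramp_ge0 (x i) d y; have := ramp_ge0 (x i - d) d y.
  have := ramp_le1 (x i) d y; have := ramp_le1 (x i - d) d y.
  by move=> *; apply/andP; split; lra.
have T : \forall n \near \oo, `|avg (ys n) (fun y => f y - g y)| <= e + e.
  apply: (avg_tail dfg (ltW e_gt0)); last by rewrite ltrDl.
  by move=> y; rewrite ler_norml => /andP[y1 y2]; apply: fg; apply/andP; split; lra.
have A : \forall n \near \oo, `|Lg - avg (ys n) g| <= e.
  by move/cvgrPdist_le : avg_g; apply.
near=> n.
have Tn : `|avg (ys n) (fun y => f y - g y)| <= e + e by near: n.
have An : `|Lg - avg (ys n) g| <= e by near: n.
rewrite avgB in Tn.
have e5 : e0 = 5 * e by rewrite /e; field.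
move: int_fg Lg_int Tn An; rewrite e5 !ler_norml.
by move=> /andP[? ?] /andP[? ?] /andP[? ?] /andP[? ?]; apply/andP; split; lra.
Unshelve. all: by end_near. Qed.

End limit_measure.

End moment_limit.

(** * The theorem *)

Section fock_walk.
Variables (K : fieldType) (m : nat -> K) (r : K).

(** Rescaling by [r] per cell turns [r push + r pop] into [push + r^2 pop], in which only the square
    of [r] occurs. *)
Lemma fock_walk j k s :
  r ^+ size s * ((shift K + r *: semicircular m) ^+ j) (vacuum m) (k, s) =
  walk m (r ^+ 2) j (k, s).
Proof.
elim: j k s => [|j IH] k s.
  by case: s => [|i s]; [rewrite mul1r|rewrite /= mulr0].
set X := shift K + r *: semicircular m in IH *.
rewrite endo_expS; set G := (X ^+ j) (vacuum m) in IH *.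
have -> : X G (k, s) =
  G (k.+1, s) + r * (G (0%N, k :: s) + pop_fun m G (k, s)) by [].
rewrite [RHS]/= -!IH /pop_fun/=; case: s => [|i s] /=.
  by rewrite mulr0 !addr0 expr0 expr1 !mul1r.
rewrite -IH /GRing.scale/= !exprS; ring.
Qed.

End fock_walk.

(** At time 0 a pushed cell is never removed, so only shifts contribute. *)
Lemma walk_tau0 (S : comNzRingType) (m : nat -> S) j k : walk m 0 j (k, [::]) = m (k + j)%N.
Proof.
elim: j k => [|j IH] k; first by rewrite addn0.
rewrite /= IH (walk_split m 0 j 0 [::]) !mul0r !addr0.
by rewrite addSnnS.
Qed.

(** * Roots of the flow of a real-rooted polynomial *)

Section real_rooted_polynomials.
Variable R : realType.

Lemma real_roots_lin (p : {poly R}) : p != 0 -> only_real_roots p ->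
  p = lead_coef p *: \prod_(x <- real_roots p) ('X - x%:P).
Proof.
move=> p0 /only_real_roots_split[xs e]; rewrite {1}e; congr (_ *: _).
apply: perm_big; rewrite perm_sym e; apply: real_roots_perm.
by rewrite lead_coef_eq0.
Qed.

Lemma size_real_roots (p : {poly R}) n : size p = n.+1 -> only_real_roots p ->
  size (real_roots p) = n.
Proof.
move=> sp rp; have p0 : p != 0 by rewrite -size_poly_eq0 sp.
apply: succn_inj; rewrite -sp {2}(real_roots_lin p0 rp) size_scale ?lead_coef_eq0//.
by rewrite size_prod_XsubC.
Qed.

Lemma heat_flow_real_roots (t : R) (p : {poly R}) n : t <= 0 ->
  size p = n.+1 -> only_real_roots p ->
  let ys := real_roots (heat_flow t p) in
  [/\ size (heat_flow t p) = n.+1, size ys = n &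
    \prod_(y <- ys) ('X - y%:P) =
    heat_flow t (\prod_(x <- real_roots p) ('X - x%:P))].
Proof.
move=> t0 sp rp ys; have p0 : p != 0 by rewrite -size_poly_eq0 sp.
have [zs sz hz] := heat_flow_lin (real_roots p) t0.
have hp : heat_flow t p = lead_coef p *: \prod_(z <- zs) ('X - z%:P).
  by rewrite {1}(real_roots_lin p0 rp) heat_flowZ hz.
have l0 : lead_coef p != 0 by rewrite lead_coef_eq0.
have pys : perm_eq ys zs by rewrite /ys hp; exact: real_roots_perm.
split.
- by rewrite hp size_scale// size_prod_XsubC sz (size_real_roots sp).
- by rewrite (perm_size pys) sz (size_real_roots sp).
- by rewrite hz; exact: perm_big.
Qed.

Lemma heat_coef_heat_flow n (xs : seq R) (s : R) k :
  size xs = n -> (k <= n)%N ->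
  (heat_flow (- (s / n%:R)) (\prod_(x <- xs) ('X - x%:P)))`_(n - k) =
  (heat_coef n (\prod_(x <- xs) ('X - x%:P)) (- (n%:R *+ 2)^-1) k).[s].
Proof.
move=> sx kn; rewrite /heat_flow size_prod_XsubC sx /heat_coef kn.
rewrite coef_sum horner_sum; apply: eq_bigr => i _.
have -> : - (s / n%:R) / 2 = - (n%:R *+ 2)^-1 * s.
  by rewrite -[n%:R *+ 2]mulr_natr invfM; ring.
by rewrite coefZ hornerZ hornerXn exprMn; ring.
Qed.

End real_rooted_polynomials.

Section main.
Variables (R : realType) (P : nat -> {poly R}) (C r : R).
Variable mu : probability (measurableTypeR R) R.
Hypothesis degP : forall n : nat, (0 < n)%N -> size (P n) = n.+1.
Hypothesis realP : forall n : nat, (0 < n)%N -> only_real_roots (P n).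
Hypothesis boundP : forall n : nat, (0 < n)%N ->
  forall z : R, root (P n) z -> - C <= z <= C.
Hypothesis mu_supp : mu [set` `[- C, C]] = 1%E.
Hypothesis cvgP : weak_cvg (fun n => empirical_roots (P n)) mu.
Hypothesis r_gt0 : 0 < r.

Let mom k : R := (\int[mu]_x (x ^+ k))%R.
Let xs n := real_roots (P n.+1).
Let H n := heat_flow (- (r ^+ 2 / n.+1%:R)) (P n.+1).
Let ys n := real_roots (H n).

Let C0 : 0 <= C.
Proof.
rewrite leNgt; apply/negP => C0; move: mu_supp; rewrite set_itv_ge ?measure0.
  by move=> /eqP; rewrite lt_eqF// lte01.
by rewrite bnd_simp -ltNge; lra.
Qed.

Let mu_out : mu (~` [set` `[- C, C]]) = 0%E.
Proof. by rewrite probability_setC ?mu_supp ?subee//; exact: measurable_itv. Qed.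

Let Rintegral_supp (f g : R -> R) : continuous f -> continuous g ->
  (forall x, - C <= x <= C -> f x = g x) -> (\int[mu]_x f x)%R = (\int[mu]_x g x)%R.
Proof.
move=> cf cg fg; rewrite !(supported_Rintegral mu_out)//.
by apply: eq_Rintegral => x; rewrite inE/= in_itv/= => /fg.
Qed.

Let mom_bound k : `|mom k| <= C ^+ k.
Proof.
have cX j : continuous (fun x : R => x ^+ j) by move=> x; exact: exprn_continuous.
rewrite /mom (supported_Rintegral mu_out)//.
have mI : measurable ([set` `[- C, C]] : set (measurableTypeR R)) by exact: measurable_itv.
have int f : continuous f -> mu.-integrable [set` `[- C, C]] (EFin \o f).
  by move=> cf; apply: (integrableS measurableT) => //; exact: (supported_integrable mu_out).
rewrite (le_trans (le_normr_Rintegral mI (int _ (cX k))))//.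
have : (\int[mu]_(x in [set` `[- C, C]]) `|x ^+ k| <= \int[mu]_(x in [set` `[- C, C]]) (cst (C ^+ k) x))%R.
  apply: le_Rintegral => //.
  - exact: integrable_norm (int _ (cX k)).
  - by apply: int => x; exact: cvg_cst.
  - move=> x /=; rewrite in_itv/= -ler_norml => xC.
    by rewrite normrX lerXn2r// nnegrE.
by move=> /le_trans; apply; rewrite Rintegral_cst// [X in _ * fine X]mu_supp mulr1.
Qed.

Let mom0 : mom 0 = 1.
Proof.
rewrite /mom (@eq_Rintegral _ _ _ mu setT (cst 1)) ?Rintegral_cst//.
by rewrite [X in _ * fine X]probability_setT mulr1.
Qed.

Let size_xs n : size (xs n) = n.+1.
Proof. by apply: size_real_roots; [exact: degP|exact: realP]. Qed.

Let tn_le0 n : - (r ^+ 2 / n.+1%:R) <= 0.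
Proof. by rewrite oppr_le0 divr_ge0 ?sqr_ge0. Qed.

Let size_ys n : size (ys n) = n.+1.
Proof. by case: (heat_flow_real_roots (tn_le0 n) (degP (ltn0Sn n)) (realP (ltn0Sn n))). Qed.

Let size_H n : size (H n) = n.+2.
Proof. by case: (heat_flow_real_roots (tn_le0 n) (degP (ltn0Sn n)) (realP (ltn0Sn n))). Qed.

Let xs_bound n x : x \in xs n -> - C <= x <= C.
Proof.
move=> xx; apply: (@boundP n.+1) => //.
have p0 : P n.+1 != 0 by rewrite -size_poly_eq0 degP.
rewrite (real_roots_lin p0 (realP (ltn0Sn n))) rootZ ?lead_coef_eq0//.
by rewrite root_prod_XsubC.
Qed.

Let mom_xs k : avg (xs n) (fun x => x ^+ k) @[n --> \oo] --> mom k.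
Proof.
(* Weak convergence tests bounded functions only. Clamping to [[- C, C]] bounds the powers and
   changes neither the averages nor the limit integral. *)
pose clamp (x : R) := Num.max (- C) (Num.min C x).
have cc : continuous clamp.
  move=> x; apply: (@continuous_max _ _ (cst (- C)) (Num.min C)); first exact: cvg_cst.
  by apply: (@continuous_min _ _ (cst C) id); [exact: cvg_cst|exact: cvg_id].
have clampE x : - C <= x <= C -> clamp x = x.
  by move=> /andP[x1 x2]; rewrite /clamp min_r// max_r.
have clamp_bound x : `|clamp x| <= C.
  by rewrite ler_norml le_max lexx/= ge_max ge_min lexx/= andbT; have := C0; lra.
have cf : continuous (fun x => clamp x ^+ k).
  by move=> x; apply: (continuous_comp (g := fun y : R => y ^+ k) (cc x)); exact: exprn_continuous.
have := cvgP cf (ex_intro _ (C ^+ k) _).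
have clampX x : `|clamp x ^+ k| <= C ^+ k by rewrite normrX lerXn2r// nnegrE.
move=> /(_ clampX).
rewrite -cvg_shiftS (Rintegral_supp cf (g := fun x => x ^+ k)); last 2 first.
- by move=> x; exact: exprn_continuous.
- by move=> x /clampE ->.
apply: cvg_trans; apply: near_eq_cvg; apply: nearW => n.
rewrite /= Rintegral_empirical_roots// degP// /avg size_xs; congr (_ * _).
by apply: eq_big_seq => x /xs_bound/clampE ->.
Qed.

Let c k : R := walk mom (r ^+ 2) k (0%N, [::]).

Let c_bound k : `|c k| <= (C + r *+ 2) ^+ k.
Proof.
have := walk_bound k (0%N, [::]) C0 (ltW r_gt0) mom_bound.
by rewrite /= !mulr1.
Qed.

(** The polynomial variable is the time [s], with the flow at [- s / n.+1]: the value at 0 belongs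
    to [xs n], the value at [r ^ 2] to [ys n]. *)
Let mom_ys k : avg (ys n) (fun x => x ^+ k) @[n --> \oo] --> c k.
Proof.
have HM n : exists M : fps {poly R},
    [/\ fps_deriv M *+ 2 = euler (fpsX _ * fpsX _ *
           (M * M - fpsC (n.+1%:R^-1)%:P * (euler M + M))),
        forall k, (M k).[0] = n.+1%:R^-1 * power_sums (xs n) k &
        forall k, (M k).[r ^+ 2] = n.+1%:R^-1 * power_sums (ys n) k].
  apply: heat_moments; rewrite ?size_xs ?size_ys// => j jn.
  have [_ _ ->] := heat_flow_real_roots (tn_le0 n) (degP (ltn0Sn n)) (realP (ltn0Sn n)).
  by apply: heat_coef_heat_flow => //; exact: size_xs.
have [M_ M_P] := choice HM.
pose M := walk_series (fun k => (mom k)%:P) 'X 0%N.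
have Mt t j : (M j).[t] = walk mom t j (0%N, [::]).
  rewrite /M /walk_series -[LHS]/(horner_eval t _) walk_morph/= /horner_eval hornerX.
  by congr walk; apply/funext => i /=; rewrite /horner_eval hornerC.
have -> : c k = (M k).[r ^+ 2] by rewrite Mt.
have E n : avg (ys n) (fun x => x ^+ k) = (M_ n k).[r ^+ 2].
  by case: (M_P n) => _ _ ->; rewrite /avg size_ys.
under eq_fun do rewrite E.
apply: (@fps_heat_cvg R M_ M (fun n => n.+1%:R^-1)).
- exact: cvg_harmonic.
- by move=> n; case: (M_P n).
- exact: walk_series_heat.
- move=> j; rewrite Mt walk_tau0 add0n.
  have E0 n : (M_ n j).[0] = avg (xs n) (fun x => x ^+ j).
    by case: (M_P n) => _ -> _; rewrite /avg size_xs.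
  by under eq_fun do rewrite E0; exact: mom_xs.
Qed.

Local Open Scope complex_scope.

Lemma heat_flow_free_convolution :
  exists2 nu : probability (measurableTypeR R) R,
    is_free_convolution mu (semicircle r) nu &
    weak_cvg (fun n => empirical_roots (heat_flow (- (r ^+ 2 / n%:R)) (P n))) nu.
Proof.
have ys_gt0 n : (0 < size (ys n))%N by rewrite size_ys.
have K0 : 0 <= C + r *+ 2 by rewrite addr_ge0// mulrn_wge0// ltW.
have [nu nuF] := limit_probability ys_gt0 K0 c_bound mom_ys.
have cvg_nu := avg_cvg_limit ys_gt0 K0 c_bound mom_ys nuF.
have nu_out := limit_support ys_gt0 K0 c_bound mom_ys nuF.
(* Bounded functions and powers are both of polynomial growth, so [cvg_nu] yields weak convergence
   as well as the moments of [nu]. *)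
exists nu; last first.
  move=> f cf [M fM]; rewrite -cvg_shiftS.
  apply: cvg_trans (cvg_nu f cf (dominated_off_bounded _ fM)).
  apply: near_eq_cvg; apply: nearW => n /=.
  by rewrite Rintegral_empirical_roots// size_H /avg size_ys.
have nu_mom k : (\int[nu]_x (x ^+ k))%R = c k.
  have cX : continuous (fun x : R => x ^+ k) by move=> x; exact: exprn_continuous.
  have dX : dominated_off (C + r *+ 2 + 1) (fun x : R => x ^+ k).
    rewrite (_ : (fun x => x ^+ k) = horner 'X^k); last first.
      by apply/funext => x; rewrite hornerXn.
    by apply: dominated_off_poly; rewrite lerDr.
  have h1 := cvg_nu _ cX dX; have h2 := mom_ys (k := k).
  by rewrite -(cvg_lim _ h1)// -(cvg_lim _ h2).
split.
- by exists C.
- by exists (2 * `|r|); exact: semicircle_supp.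
- by exists (C + r *+ 2 + 1 + 1).
pose m k : R[i] := (mom k)%:C.
have m0 : m 0%N = 1 by rewrite /m mom0.
exists (fock_endo R[i]), (fock_ev m), (shift R[i]), (r%:C *: semicircular m).
split.
- exact: fock_ev1.
- by move=> s; exact: fock_freely_independent.
- by move=> k; exact: fock_ev_shiftX.
- by move=> k; exact: semicircle_moment.
- move=> k; rewrite nu_mom /c (walk_morph (real_complex R)).
  by rewrite -[LHS]mul1r (fock_walk m r%:C k 0 [::]) rmorphXn.
Qed.

End main.

Theorem theorem2p13 (R : realType) (P : nat -> {poly R}) (C : R)
    (mu : probability (measurableTypeR R) R) (r : R)
    (degP : forall n : nat, (0 < n)%N -> size (P n) = n.+1)
    (realP : forall n : nat, (0 < n)%N -> only_real_roots (P n))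
    (boundP : forall n : nat, (0 < n)%N ->
       forall z : R, root (P n) z -> - C <= z <= C)
    (mu_supp : mu [set` `[- C, C]] = 1%E)
    (cvgP : weak_cvg (fun n => empirical_roots (P n)) mu)
    (r_gt0 : 0 < r) :
  exists2 nu : probability (measurableTypeR R) R,
    is_free_convolution mu (semicircle r) nu &
    weak_cvg (fun n => empirical_roots (heat_flow (- (r ^+ 2 / n%:R)) (P n))) nu.
Proof. exact: heat_flow_free_convolution degP realP boundP mu_supp cvgP r_gt0. Qed.
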